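(* Let $K\subseteq\mathbb{R}$ be compact and let $F=(F^k)_{k=0}^\infty$, $G=(G^k)_{k=0}^\infty$, $H=(H^k)_{k=0}^\infty$ be collections of continuous, real-valued functions on $K$. There is a horizontal curve $\Gamma\in C^\infty(\mathbb{R},\mathbb{R}^3)$ satisfying $D^k\Gamma|_K=(F^k,G^k,H^k)$ for all $k\in\mathbb{N}_0$ if and only if there are constants $\hat C_m>0$ ($m\in\mathbb{N}_0$) such that the following hold: 1. for every $m\in\mathbb{N}_0$, $(F^k)_{k=0}^m$, $(G^k)_{k=0}^m$, and $(H^k)_{k=0}^m$ are Whitney fields of class $C^m$ on $K$; 2. for every $m\geq 1$, on $K$, $$H^m=2\sum_{i=0}^{m-1}\binom{m-1}{i}\left(F^{m-i}G^i-G^{m-i}F^i\right);$$ 3. for every $m\in\mathbb{N}_0$, writing $\gamma=(F,G,H)$, $$|A^m(\gamma;a,b)|\leq\hat C_m V^m_x(\gamma;a,b)\qquad\text{for all }a,b\in K\text{ with }a<b.$$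
   Context: $\mathbb{N}_0=\{0,1,2,\dots\}$. A collection $(F^k)_{k=0}^m$ of continuous real-valued functions on a compact set $K\subset\mathbb{R}$ is a Whitney field of class $C^m$ on $K$ if for every $0\leq k\leq m$ the quantity $(R_a^mF)^k(b)=F^k(b)-\sum_{\ell=0}^{m-k}\frac{F^{k+\ell}(a)}{\ell!}(b-a)^\ell$ is uniformly $o(|a-b|^{m-k})$ on $K$: for every $\varepsilon>0$ there is $\delta>0$ such that $|(R_a^mF)^k(b)|\leq\varepsilon|b-a|^{m-k}$ whenever $a,b\in K$ and $|b-a|<\delta$. A curve $(f,g,h):\mathbb{R}\to\mathbb{R}^3$ is horizontal (in the Heisenberg group $\mathbb{H}=\mathbb{R}^3$ with group law $(x,y,z)*(x',y',z')=(x+x',y+y',z+z'+2(yx'-xy'))$) if it is absolutely continuous and its derivative lies a.e. in the span of the vector fields $\partial_x+2y\,\partial_z$ and $\partial_y-2x\,\partial_z$ along the curve; equivalently, $h'=2(f'g-fg')$ a.e. Let $T_aF(x)=\sum_{k=0}^m\frac{F^k(a)}{k!}(x-a)^k$ and similarly $T_aG$ (Taylor polynomials of order $m$). For $\gamma=(F,G,H)$ and $a,b\in K$, the area discrepancy is $$A^m(\gamma;a,b)=H^0(b)-H^0(a)-2\int_a^b\big((T_aF)'T_aG-(T_aG)'T_aF\big)+2F^0(a)\big(G^0(b)-T_aG(b)\big)-2G^0(a)\big(F^0(b)-T_aF(b)\big),$$ and for $a<b$ the velocity (with modulus of continuity $\omega(t)=t$) is $$V^m_x(\gamma;a,b)=(b-a)^{2m+2}+(b-a)^{m+1}\int_a^b\big(|(T_aF)'|+|(T_aG)'|\big).$$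 *)

(* Defs.v *)
From HB Require Import structures.
From mathcomp Require Export all_boot all_order all_algebra.
From mathcomp Require Export all_classical all_reals all_analysis.

Set Implicit Arguments.
Unset Strict Implicit.
Unset Printing Implicit Defensive.

Export Order.TTheory GRing.Theory Num.Theory.
Export numFieldNormedType.Exports.

Local Open Scope ring_scope.
Local Open Scope classical_set_scope.

(* A collection (F^k)_k of functions on K is a sequence F : nat -> R -> R of
   total functions of which only the values on K matter; continuity on K is
   {within K, continuous F k}. *)

(* (R_a^m F)^k (b), meant for k <= m since m - k is truncated. *)
Definition whitney_remainder (R : realType) (F : nat -> R -> R) (m k : nat)
    (a b : R) : R :=
  F k b - \sum_(l < (m - k).+1) F (k + l)%N a / l`!%:R * (b - a) ^+ l.

Definition whitney_field (R : realType) (m : nat) (K : set R)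
    (F : nat -> R -> R) : Prop :=
  (forall k, (k <= m)%N -> {within K, continuous (F k)}) /\
  (forall k, (k <= m)%N -> forall eps : R, 0 < eps ->
    exists2 delta : R, 0 < delta &
      forall a b : R, K a -> K b -> `|b - a| < delta ->
        `|whitney_remainder F m k a b| <= eps * `|b - a| ^+ (m - k)).

Definition smooth (R : realType) (f : R -> R) : Prop :=
  forall (k : nat) (x : R), derivable (f^`(k)) x 1.

Definition abs_continuous_on (R : realType) (c d : R) (f : R -> R) : Prop :=
  forall eps : R, 0 < eps -> exists2 delta : R, 0 < delta &
    forall (n : nat) (u v : 'I_n -> R),
      (forall i, c <= u i /\ u i <= v i /\ v i <= d) ->
      trivIset [set: 'I_n] (fun i => `]u i, v i[) ->
      \sum_i (v i - u i) < delta ->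
      \sum_i `|f (v i) - f (u i)| < eps.

(* For curves defined on the whole line, absolute continuity is required on
   every compact interval: t |-> t ^+ 2 would violate a global version. *)
Definition abs_continuous (R : realType) (f : R -> R) : Prop :=
  forall c d : R, abs_continuous_on c d f.

(* Values at p = (x, y, z) of the left invariant fields d/dx + 2 y d/dz and
   d/dy - 2 x d/dz of the Heisenberg group. *)
Definition heis_X (R : realType) (p : R * R * R) : R * R * R :=
  (1, 0, 2 * p.1.2).

Definition heis_Y (R : realType) (p : R * R * R) : R * R * R :=
  (0, 1, - (2 * p.1.1)).

Definition horizontal (R : realType) (f g h : R -> R) : Prop :=
  [/\ abs_continuous f, abs_continuous g, abs_continuous h &
    {ae (@lebesgue_measure R), forall t : R,
      [/\ derivable f t 1, derivable g t 1, derivable h t 1 &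
        exists u v : R, (f^`() t, g^`() t, h^`() t) =
          u *: heis_X (f t, g t, h t) + v *: heis_Y (f t, g t, h t)]}].

(* T_a F, of order m. *)
Definition taylor_poly (R : realType) (F : nat -> R -> R) (m : nat) (a : R)
    : {poly R} :=
  \sum_(k < m.+1) (F k a / k`!%:R) *: ('X - a%:P) ^+ k.

(* The integrals below are over the set `[a, b], hence agree with the oriented
   integral from a to b for a <= b, the only case in which they are used. *)
Definition area_discrepancy (R : realType) (F G H : nat -> R -> R) (m : nat)
    (a b : R) : R :=
  let P := taylor_poly F m a in
  let Q := taylor_poly G m a in
  H 0%N b - H 0%N a
  - 2 * (\int[@lebesgue_measure R]_(x in `[a, b])
           ((deriv P).[x] * Q.[x] - (deriv Q).[x] * P.[x]))
  + 2 * F 0%N a * (G 0%N b - Q.[b])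
  - 2 * G 0%N a * (F 0%N b - P.[b]).

Definition velocity (R : realType) (F G : nat -> R -> R) (m : nat) (a b : R)
    : R :=
  (b - a) ^+ (2 * m + 2) +
  (b - a) ^+ m.+1 *
    (\int[@lebesgue_measure R]_(x in `[a, b])
       (`|(deriv (taylor_poly F m a)).[x]| +
        `|(deriv (taylor_poly G m a)).[x]|)).

(* Main.v *)
Require Import Defs.
From mathcomp Require Import ring lra zify.

(* A smooth function is handled through its jet, the sequence of all its
   derivatives.  For the restriction of a horizontal curve, the integrand of the
   area discrepancy at a differs from that of the vanishing quantity
   H(b) - H(a) - 2 int (f' g - g' f) by terms that are bilinear in the Taylor
   remainders and in (remainder, Taylor polynomial), and the velocity bounds both.

   Conversely, extend F and G to smooth f and g: on a gap (a, b) of K, blend two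
   functions realizing the jets at a and at b (Borel's theorem, with bounds
   uniform in the point).  The same estimate shows that the area deficit
   H(b) - H(a) - 2 int_a^b (f' g - g' f) is O(V^m(a, b)) for every m.  It is then
   removed gap by gap with compactly supported corrections of f and g whose
   derivatives of order k < p are at most b - a as soon as b - a < delta_p; taking
   p -> oo as b - a -> 0, the corrections glue to smooth functions flat on K.  The
   third coordinate is twice the primitive of f' g - g' f; it agrees with H on K
   because the difference is constant across gaps and has derivative 0 on K. *)

Set Implicit Arguments.
Unset Strict Implicit.
Unset Printing Implicit Defensive.

Local Open Scope ring_scope.
Local Open Scope classical_set_scope.

(** * Derivatives and primitives *)

(** A correction of amplitude A supported in an interval of length r costs about A r^-k in its k-th
    derivative, so the area deficit of a gap of length l must beat powers of l. Assumption 3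
    provides every power, but with constants C_m that need not be uniform in m: this is why delta_p
    depends on p and why the controlled order can only grow as the gaps shrink.

    The complement of K consists of bounded gaps only after two half-lines at distance at least 1
    from K are added to it; the fields are continued by 0 there. The Whitney extension and the
    corrections are then two uses of the same gluing lemma. Assumption 2 is the Leibniz expansion of
    the derivatives of 2(F'G - G'F), so the third coordinate has to be matched with H at order 0
    only.

    Integrals are treated through primitives: an estimate between integrals becomes a comparison of
    derivatives. *)

Section Calculus.
Variable R : realType.
Implicit Types (u v f g : R -> R) (x a b : R).

Lemma is_derive_continuous f x (l : R) :
  is_derive x (1 : R) f l -> {for x, continuous f}.
Proof. by move=> df; apply/differentiable_continuous/derivable1_diffP. Qed.

(** Free of division, this form allows y = x and can be checked separately on each side of x, as the
    gluing does. *)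
Lemma is_derive_epsP f x (l : R) :
  is_derive x (1 : R) f l <->
  forall eps : R, 0 < eps -> exists2 delta : R, 0 < delta &
    forall y, `|y - x| < delta ->
      `|f y - f x - l * (y - x)| <= eps * `|y - x|.
Proof.
split=> [[df dfl] eps e0|H].
  have : h^-1 *: ((f \o shift x) (h *: (1 : R)) - f x) @[h --> 0^'] --> l.
    by rewrite -dfl; exact: df.
  move=> /cvgrPdist_le /(_ _ e0).
  rewrite near_withinE => /nbhs_ballP[d /= d0 H]; exists d => // y yx.
  have [->|xy] := eqVneq y x; first by rewrite !subrr mulr0 subrr normr0 mulr0.
  have yx0 : y - x != 0 by rewrite subr_eq0.
  have := H (y - x); rewrite /ball /= sub0r normrN => /(_ yx yx0).
  rewrite /shift /= /GRing.scale /= mulr1 subrK => Hl.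
  rewrite -ler_pdivrMr ?normr_gt0// -normf_div.
  by rewrite mulrBl mulfK// distrC (mulrC (f y - f x)).
have cv : h^-1 *: ((f \o shift x) (h *: (1 : R)) - f x) @[h --> 0^'] --> l.
  apply/cvgrPdist_le => eps e0; have [d d0 Hd] := H _ e0.
  rewrite near_withinE; apply/nbhs_ballP; exists d => //= h.
  rewrite /ball /= sub0r normrN => hd h0.
  rewrite /shift /= /GRing.scale /= mulr1.
  have := Hd (h + x); rewrite addrK => /(_ hd).
  rewrite -ler_pdivrMr ?normr_gt0// -normf_div mulrBl mulfK// distrC.
  by rewrite (mulrC h^-1).
apply: DeriveDef; first by apply/cvg_ex; exists l.
exact: (cvg_lim (@norm_hausdorff _ _) cv).
Qed.

Lemma is_derive_ext f g x (l : R) :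
  f =1 g -> is_derive x (1 : R) f l -> is_derive x (1 : R) g l.
Proof. by move=> /funext ->. Qed.

Lemma is_derive_near f g x (l d : R) : 0 < d ->
  (forall y, `|y - x| < d -> f y = g y) ->
  is_derive x (1 : R) f l -> is_derive x (1 : R) g l.
Proof.
move=> d0 fg; apply: near_eq_is_derive.
by apply/nbhs_ballP; exists d => //= y; rewrite /ball /= distrC; exact: fg.
Qed.

Lemma is_derive_add f g x (l m : R) :
  is_derive x (1 : R) f l -> is_derive x (1 : R) g m ->
  is_derive x (1 : R) (fun y => f y + g y) (l + m).
Proof. by move=> df dg; exact: is_deriveD. Qed.

Lemma is_derive_sub f g x (l m : R) :
  is_derive x (1 : R) f l -> is_derive x (1 : R) g m ->
  is_derive x (1 : R) (fun y => f y - g y) (l - m).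
Proof. by move=> df dg; exact: is_deriveB. Qed.

Lemma is_derive_mul f g x (l m : R) :
  is_derive x (1 : R) f l -> is_derive x (1 : R) g m ->
  is_derive x (1 : R) (fun y => f y * g y) (l * g x + f x * m).
Proof.
move=> df dg; have dM := @is_deriveM _ _ _ _ x 1 _ _ df dg.
by apply: (is_derive_eq dM); rewrite /GRing.scale /=; ring.
Qed.

Lemma is_derive_scale f x (c l : R) :
  is_derive x (1 : R) f l -> is_derive x (1 : R) (fun y => c * f y) (c * l).
Proof. by move=> df; exact: (@is_deriveZ _ _ _ f c x 1 l). Qed.

Lemma is_derive_const x (c : R) : is_derive x (1 : R) (fun=> c) 0.
Proof. exact: is_derive_cst. Qed.

Lemma is_derive_exp f x (l : R) n : is_derive x (1 : R) f l ->
  is_derive x (1 : R) (fun y => f y ^+ n.+1) (n.+1%:R * f x ^+ n * l).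
Proof.
move=> df; elim: n => [|n IH].
  by apply: is_derive_ext (is_derive_eq df _) => [y|]; rewrite ?expr1// expr0; ring.
apply: is_derive_ext (is_derive_eq (is_derive_mul df IH) _) => [y|].
  by rewrite -exprS.
rewrite -[n.+2%:R]natr1 (exprS _ n).
by ring.
Qed.

Lemma is_derive_affine f x (c d l : R) : is_derive (c * x + d) (1 : R) f l ->
  is_derive x (1 : R) (fun y => f (c * y + d)) (c * l).
Proof.
move=> df; have da : is_derive x (1 : R) (fun y => c * y + d) c.
  apply: (is_derive_eq (is_derive_add (is_derive_scale c _) (is_derive_const x d))).
  by rewrite addr0 mulr1.
by rewrite mulrC; exact: (@is_derive1_comp R f _ x l c).
Qed.

Lemma is_derive_sum n (f : 'I_n -> R -> R) x (l : 'I_n -> R) :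
  (forall i, is_derive x (1 : R) (f i) (l i)) ->
  is_derive x (1 : R) (fun y => \sum_(i < n) f i y) (\sum_(i < n) l i).
Proof.
elim: n f l => [|n IH] f l df.
  apply: (is_derive_ext (f := fun=> 0)) => [y|]; first by rewrite big_ord0.
  by rewrite big_ord0; exact: is_derive_const.
apply: (is_derive_ext (f := fun y => \sum_(i < n) f (widen_ord (leqnSn n) i) y
    + f ord_max y)) => [y|]; first by rewrite big_ord_recr.
by rewrite big_ord_recr /=; apply: is_derive_add => //; exact: IH.
Qed.

Lemma MVT_between u v a b : (forall x, is_derive x (1 : R) u (v x)) ->
  exists c, ((a <= c <= b) || (b <= c <= a)) /\ u b - u a = v c * (b - a).
Proof.
move=> du.
have cu : continuous u by move=> x; exact: is_derive_continuous (du x).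
have [ab|/ltW ba] := leP a b.
  have [c] := MVT_segment ab (fun x _ => du x) (continuous_subspaceT cu).
  by rewrite in_itv /= => cab E; exists c; rewrite cab.
have [c] := MVT_segment ba (fun x _ => du x) (continuous_subspaceT cu).
rewrite in_itv /= => cab E; exists c; rewrite cab orbT; split=> //.
by rewrite -opprB E; ring.
Qed.

(** Stands for the bound of [|int u'|] by the integral of [v']; it follows from the mean value
    theorem for v - u and v + u. *)
Lemma ler_growth u u' v v' a b : a <= b ->
  (forall x, is_derive x (1 : R) u (u' x)) ->
  (forall x, is_derive x (1 : R) v (v' x)) ->
  (forall x, a <= x <= b -> `|u' x| <= v' x) ->
  `|u b - u a| <= v b - v a.
Proof.
move=> ab du dv H.
have [c [cab]] := @MVT_between (fun x => v x - u x) (fun x => v' x - u' x) a b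
  (fun x => is_derive_sub (dv x) (du x)).
have [d [dab]] := @MVT_between (fun x => v x + u x) (fun x => v' x + u' x) a b
  (fun x => is_derive_add (dv x) (du x)).
have /H : a <= d <= b by lra.
have /H : a <= c <= b by lra.
rewrite !ler_norml => /andP[c1 c2] /andP[d1 d2] Ed Ec.
have : 0 <= (v' d + u' d) * (b - a) by apply: mulr_ge0; lra.
have : 0 <= (v' c - u' c) * (b - a) by apply: mulr_ge0; lra.
by lra.
Qed.

Lemma ler_mvt u u' (M a b : R) :
  (forall x, is_derive x (1 : R) u (u' x)) ->
  (forall x, (a <= x <= b) || (b <= x <= a) -> `|u' x| <= M) ->
  `|u b - u a| <= M * `|b - a|.
Proof.
move=> du H; have [c [cab ->]] := MVT_between a b du.
by rewrite normrM ler_wpM2r// H.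
Qed.

Lemma primitive_from f a : continuous f ->
  exists F, forall x, a < x -> is_derive x (1 : R) F (f x).
Proof.
move=> cf; exists (fun x => \int[@lebesgue_measure R]_(t in `[a, x]) f t)%R.
move=> x ax.
have xx1 : x < x + 1 by lra.
have fi : (@lebesgue_measure R).-integrable `[a, x + 1] (EFin \o f).
  apply: continuous_compact_integrable; first exact: segment_compact.
  exact: continuous_subspaceT.
have [dF F'] := continuous_FTC1_closed xx1 fi ax (cf x).
by split; [exact: dF|rewrite -derive1E; exact: F'].
Qed.

(* On ]-(n+1), oo[ take the primitive vanishing at 0; these agree. *)
Lemma continuous_primitive f : continuous f ->
  exists F, forall x, is_derive x (1 : R) F (f x).
Proof.
move=> cf.
have /choice[G GE] : forall n : nat, exists G : R -> R,
    G 0 = 0 /\ forall x, - (n%:R + 1) < x -> is_derive x (1 : R) G (f x).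
  move=> n; have [F HF] := primitive_from (- (n%:R + 1)) cf.
  exists (fun x => F x - F 0); split=> [|x nx]; first by rewrite subrr.
  by apply: (is_derive_eq (is_derive_sub (HF _ nx) (is_derive_const x _))); lra.
have same n p x : - (n%:R + 1) < x -> - (p%:R + 1) < x -> G n x = G p x.
  move=> nx px.
  pose w y := G n y - G p y.
  have n0 : 0 <= n%:R :> R by []. have p0 : 0 <= p%:R :> R by [].
  have dw (y : R) : - (n%:R + 1) < y -> - (p%:R + 1) < y -> is_derive y (1 : R) w 0.
    move=> ny py; rewrite -(subrr (f y)).
    exact: is_derive_sub ((GE n).2 _ ny) ((GE p).2 _ py).
  have w0 : w 0 = 0 by rewrite /w (GE n).1 (GE p).1 subrr.
  suff : w x = w 0 by rewrite w0 => /eqP; rewrite subr_eq0 => /eqP.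
  have cw (a b : R) : - (n%:R + 1) < a -> - (p%:R + 1) < a ->
      {within `[a, b], continuous w}.
    move=> na pa; apply/subspace_continuousP => y /=; rewrite in_itv /=.
    move=> /andP[ay yb]; apply: cvg_within_filter.
    by apply: is_derive_continuous; apply: dw; lra.
  have dw' (a b y : R) : - (n%:R + 1) < a -> - (p%:R + 1) < a ->
      y \in `]a, b[%R -> is_derive y (1 : R) w 0.
    by move=> na pa; rewrite in_itv /= => yab; apply: dw; lra.
  have [x0|/ltW x0] := leP 0 x.
    have [||c _] := @MVT_segment _ w (fun=> 0) 0 x x0; last lra.
    - by move=> y; apply: dw'; lra.
    - by apply: cw; lra.
  have [||c _] := @MVT_segment _ w (fun=> 0) x 0 x0; last lra.
  - by move=> y; apply: dw'; lra.
  - by apply: cw; lra.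
pose N x := Num.truncn `|x|.
have NP x : - ((N x)%:R + 1) < x.
  have := truncnS_gt `|x|; rewrite -/(N x) -natr1; have := ler_norm (- x).
  by rewrite normrN; lra.
exists (fun x => G (N x) x) => x.
have NPx := NP x; have dG := (GE (N x)).2 _ NPx.
have d0 : 0 < x + ((N x)%:R + 1) by lra.
apply: (is_derive_near d0) dG => y.
by rewrite ltr_norml => /andP[y1 _]; apply: same => //; lra.
Qed.

Lemma Rintegral_primitive f F a b : a < b -> continuous f ->
  (forall x, is_derive x (1 : R) F (f x)) ->
  (\int[@lebesgue_measure R]_(x in `[a, b]) f x)%R = F b - F a.
Proof.
move=> ab cf dF.
have cF x : {for x, continuous F} by exact: is_derive_continuous (dF x).
rewrite /Rintegral (@continuous_FTC2 _ f F)//.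
- exact: continuous_subspaceT.
- split=> [x _||]; first exact: (@ex_derive _ _ _ _ _ _ _ (dF x)).
  + by apply: cvg_at_right_filter; exact: cF.
  + by apply: cvg_at_left_filter; exact: cF.
- by move=> x _; rewrite derive1E; exact: (@derive_val _ _ _ _ _ _ _ (dF x)).
Qed.

End Calculus.

(** * Jets of smooth functions *)

Section Jets.
Variable R : realType.
Implicit Types (u v w : nat -> R -> R) (x a b c d : R).

Definition jet u := forall k x, is_derive x (1 : R) (u k) (u k.+1 x).

Lemma jet_shift u j : jet u -> jet (fun k => u (j + k)%N).
Proof. by move=> ju k x; rewrite addnS; exact: ju. Qed.

Lemma jet_const c : jet (fun k _ => if k is 0 then c else 0).
Proof. by move=> [|k] x; exact: is_derive_const. Qed.

Lemma jet_add u v : jet u -> jet v -> jet (fun k x => u k x + v k x).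
Proof. by move=> ju jv k x; exact: is_derive_add. Qed.

Lemma jet_sub u v : jet u -> jet v -> jet (fun k x => u k x - v k x).
Proof. by move=> ju jv k x; exact: is_derive_sub. Qed.

Lemma jet_scale c u : jet u -> jet (fun k x => c * u k x).
Proof. by move=> ju k x; exact: is_derive_scale. Qed.

Lemma jet_affine c d u : jet u -> jet (fun k x => c ^+ k * u k (c * x + d)).
Proof.
move=> ju k x; rewrite exprSr -mulrA; apply: is_derive_scale.
exact: is_derive_affine.
Qed.

Lemma jet_sum n (u : nat -> nat -> R -> R) : (forall i, jet (u i)) ->
  jet (fun k x => \sum_(i < n) u i k x).
Proof. by move=> ju k x; apply: is_derive_sum => i; exact: ju. Qed.

Definition jmul u v : nat -> R -> R := fun k x =>
  \sum_(i < k.+1) 'C(k, i)%:R * (u (k - i)%N x * v i x).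

Lemma jet_mul u v : jet u -> jet v -> jet (jmul u v).
Proof.
move=> ju jv k x.
have := is_derive_sum (fun i : 'I_k.+1 =>
  is_derive_scale 'C(k, i)%:R (is_derive_mul (ju (k - i)%N x) (jv i x))).
move=> /is_derive_eq; apply.
under eq_bigr do rewrite mulrDr.
(* After the two extreme terms are split off, Pascal's rule matches the remaining ones. *)
rewrite big_split /= /jmul big_ord_recl [in RHS]big_ord_recl /= !bin0 !subn0.
rewrite -addrA; congr (_ + _).
rewrite (big_ord_recr k) /= (big_ord_recr k) /= addrA; congr (_ + _); last first.
  by rewrite /bump /= add1n !binn subnn subSS subnn.
rewrite -big_split /=; apply: eq_bigr => i _.
rewrite /bump /= !add1n binS natrD subSS.
have -> : (k - i = (k - i.+1).+1)%N by have := ltn_ord i; lia.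
ring.
Qed.

Lemma jet_smooth u : jet u -> forall k, (u 0%N)^`(k) = u k.
Proof.
move=> ju; elim=> [|k IH]; first by rewrite derive1n0.
rewrite derive1nS IH; apply/funext => x; rewrite derive1E.
exact: (@derive_val _ _ _ _ _ _ _ (ju k x)).
Qed.

Lemma smoothP u : jet u -> smooth (u 0%N).
Proof.
move=> ju k x; rewrite (jet_smooth ju).
exact: (@ex_derive _ _ _ _ _ _ _ (ju k x)).
Qed.

Lemma smooth_jet (f : R -> R) : smooth f -> jet (fun k => f^`(k)).
Proof.
move=> sf k x; have dfk := sf k x.
by split; [exact: dfk|rewrite derive1nS derive1E].
Qed.

Lemma jet_continuous u k : jet u -> continuous (u k).
Proof. by move=> ju x; exact: is_derive_continuous (ju k x). Qed.

Lemma continuous_bounded (f : R -> R) a b : continuous f ->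
  exists2 M : R, 0 < M & forall x, a <= x <= b -> `|f x| <= M.
Proof.
move=> cf; have [ab|ba] := leP a b; last first.
  by exists 1 => // x; lra.
have cn : {within `[a, b], continuous (fun x => `|f x|)}.
  apply: continuous_subspaceT => x.
  by apply: continuous_comp; [exact: cf|exact: norm_continuous].
have [c cab H] := EVT_max ab cn.
exists (`|f c| + 1) => [|x xab]; first by rewrite ltr_wpDl.
by rewrite (le_trans (H x _))// ?in_itv// lerDl.
Qed.

Lemma jet_bounded u k a b : jet u ->
  exists2 M : R, 0 < M & forall x, a <= x <= b -> `|u k x| <= M.
Proof. by move=> ju; apply/continuous_bounded/jet_continuous. Qed.

(** Induction on n: the mean value theorem turns the remainder into b - a times the remainder, one
    order lower, of the derivative at an intermediate point. *)
Lemma taylor_bound u n a b (M : R) : jet u ->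
  (forall x, (a <= x <= b) || (b <= x <= a) -> `|u n x| <= M) ->
  `|u 0%N b - \sum_(l < n) u l a / l`!%:R * (b - a) ^+ l| <= M * `|b - a| ^+ n.
Proof.
elim: n u b => [|n IH] u b ju H.
  by rewrite big_ord0 subr0 mulr1 H//; have [/ltW|] := ltP a b; lra.
pose T y := u 0%N y - \sum_(l < n.+1) u l a / l`!%:R * (y - a) ^+ l.
pose T' y := u 1%N y - \sum_(l < n) u l.+1 a / l`!%:R * (y - a) ^+ l.
have dT y : is_derive y (1 : R) T (T' y).
  apply: is_derive_sub; first exact: ju.
  pose D (l : nat) : R := if l is p.+1 then u p.+1 a / p`!%:R * (y - a) ^+ p else 0.
  have -> : \sum_(l < n) u l.+1 a / l`!%:R * (y - a) ^+ l = \sum_(l < n.+1) D l.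
    by rewrite big_ord_recl /= add0r.
  apply: (is_derive_sum (l := fun i : 'I_n.+1 => D i)) => -[[|l] _] /=.
    apply: is_derive_ext (is_derive_const y (u 0%N a / 0`!%:R)) => z.
    by rewrite expr0 mulr1.
  have dl : is_derive y (1 : R) (fun z => (z - a) ^+ l.+1) (l.+1%:R * (y - a) ^+ l).
    have dya := is_derive_sub (is_derive_id y (1 : R)) (is_derive_const y a).
    by apply: is_derive_eq (is_derive_exp l dya) _; rewrite subr0 mulr1.
  have := is_derive_scale (u l.+1 a / l.+1`!%:R) dl.
  move=> /is_derive_eq; apply; rewrite factS natrM.
  have f0 : l`!%:R != 0 :> R by rewrite pnatr_eq0 -lt0n fact_gt0.
  have l0 : l.+1%:R != 0 :> R by rewrite pnatr_eq0.
  by move: f0 l0; move: (l.+1%:R) (l`!%:R) => p q q0 p0; field; rewrite p0 q0.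
have Ta : T a = 0.
  rewrite /T big_ord_recl /= subrr expr0 mulr1 fact0 divr1.
  by rewrite big1 ?addr0 ?subrr// => i _; rewrite expr0n /= mulr0.
have [c [cab]] := MVT_between a b dT.
rewrite Ta subr0 -/(T b) => ->; rewrite normrM exprSr mulrA ler_wpM2r//.
have Hc x : (a <= x <= c) || (c <= x <= a) -> `|u (1 + n)%N x| <= M.
  move=> xc; apply: H; apply/orP.
  by move: cab xc => /orP[] ? /orP[] ?; (left; lra) || (right; lra).
have := IH (fun k => u (1 + k)%N) c (jet_shift 1 ju) Hc.
rewrite /T' => /le_trans; apply.
have M0 : 0 <= M by apply: le_trans (H a _); rewrite // !lexx /= andbT; exact: le_total.
rewrite ler_wpM2l// lerXn2r// ?nnegrE//.
by case/orP: cab => cab;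
  [rewrite !ger0_norm; lra | rewrite !ler0_norm; lra].
Qed.

(* Uniform bounds on the second derivatives make the first order Taylor
   estimates pass to the limit. *)
Lemma jet_limit (S : nat -> nat -> R -> R) u (B : nat -> R) :
  (forall n, jet (S n)) -> (forall n k x, `|S n k x| <= B k) ->
  (forall k x, S n k x @[n --> \oo] --> u k x) ->
  jet u /\ forall k x, `|u k x| <= B k.
Proof.
move=> jS SB cS.
have lim_le (s : nat -> R) (l C : R) :
    s n @[n --> \oo] --> l -> (forall n, `|s n| <= C) -> `|l| <= C.
  move=> sl sC; rewrite ler_norml; apply/andP; split.
    apply: ler_cvg_to (cvg_cst (- C)) sl _; near=> n.
    by have := sC n; rewrite ler_norml => /andP[].
  apply: ler_cvg_to sl (cvg_cst C) _; near=> n.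
  by have := sC n; rewrite ler_norml => /andP[].
split; last by move=> k x; apply: lim_le (cS k x) _.
move=> k x; apply/is_derive_epsP => eps e0.
have B0 : 0 <= B k.+2 by apply: le_trans (SB 0%N k.+2 0).
exists (eps / (B k.+2 + 1)) => [|y yx]; first by rewrite divr_gt0// ltr_wpDl.
have : `|u k y - u k x - u k.+1 x * (y - x)| <= B k.+2 * `|y - x| ^+ 2.
  apply: (lim_le (fun n => S n k y - S n k x - S n k.+1 x * (y - x))).
    apply: cvgB; first by apply: cvgB; exact: cS.
    by apply: cvgM; [exact: cS|exact: cvg_cst].
  move=> n; have Bn z : (x <= z <= y) || (y <= z <= x) -> `|S n (k + 2)%N z| <= B k.+2.
    by rewrite addn2.
  apply: le_trans (taylor_bound (jet_shift k (jS n)) Bn).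
  rewrite !big_ord_recl big_ord0 /= /bump /= addn0 addn1 fact0.
  rewrite (_ : 1`! = 1)%N// !divr1 expr0 expr1 mulr1 addr0.
  by rewrite opprD addrA.
move=> /le_trans; apply.
rewrite expr2 mulrA ler_wpM2r//.
have : (B k.+2 + 1) * `|y - x| <= eps.
  by rewrite mulrC -ler_pdivlMr ?ltr_wpDl// ltW.
by have := normr_ge0 (y - x); lra.
Unshelve. all: by end_near. Qed.

End Jets.

(** * A smooth step *)

Section Step.
Variable R : realType.
Implicit Types (x y t : R) (k n : nat).

Lemma exprn_le_expR n : exists2 C : R, 0 < C &
  forall t, 0 <= t -> t ^+ n <= C * expR t.
Proof.
exists (n.+1%:R ^+ n) => [|t t0]; first by rewrite exprn_gt0.
have n0 : 0 < n.+1%:R :> R by [].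
have -> : t ^+ n = n.+1%:R ^+ n * (t / n.+1%:R) ^+ n.
  by rewrite -exprMn mulrC divfK// gt_eqF.
rewrite ler_wpM2l ?exprn_ge0//; apply: (@le_trans _ _ (expR (t / n.+1%:R) ^+ n)).
  rewrite lerXn2r ?nnegrE ?expR_ge0 ?divr_ge0//.
  by apply: le_trans (expR_ge1Dx _); rewrite lerDr.
rewrite -expRM_natl ler_expR mulrA ler_pdivrMr// mulrC.
by rewrite ler_wpM2l// ler_nat.
Qed.

Lemma horner_le_expR (p : {poly R}) n : exists2 C : R, 0 < C &
  forall t, 0 <= t -> `|p.[t] * t ^+ n| <= C * expR t.
Proof.
elim/poly_ind: p n => [|p c IH] n.
  by exists 1 => // t _; rewrite horner0 mul0r normr0 mul1r expR_ge0.
have [C1 C10 H1] := IH n.+1; have [C2 C20 H2] := exprn_le_expR n.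
exists (C1 + `|c| * C2) => [|t t0]; first by rewrite ltr_wpDr// mulr_ge0// ltW.
rewrite !hornerE mulrDl -mulrA -exprS mulrDl.
rewrite (le_trans (ler_normD _ _))// lerD ?H1// normrM -mulrA ler_wpM2l//.
by rewrite ger0_norm ?exprn_ge0// H2.
Qed.

(** On x > 0 the k-th derivative of exp(-1/x) is p_k(1/x) exp(-1/x); the recursion is the chain rule
    with (1/x)' = -(1/x)^2. *)
Fixpoint flat_poly k : {poly R} :=
  if k is j.+1 then 'X^2 * (flat_poly j - (flat_poly j)^`()) else 1.

Definition flat k x : R :=
  if 0 < x then (flat_poly k).[x^-1] * expR (- x^-1) else 0.

Lemma flat_le0 k x : x <= 0 -> flat k x = 0.
Proof. by rewrite /flat leNgt => /negbTE ->. Qed.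

Lemma flat_jet : jet flat.
Proof.
move=> k x; have [x0|x0|->] := ltgtP x 0.
- rewrite flat_le0 ?ltW//.
  apply: (@is_derive_near R (fun=> 0) _ x _ (- x)) (is_derive_const x 0).
    by rewrite oppr_gt0.
  by move=> y; rewrite ltr_norml => /andP[_ yx]; rewrite flat_le0//; lra.
- apply: (@is_derive_near R (fun y => (flat_poly k).[y^-1] * expR (- y^-1)) _ x _ x) => //.
    move=> y; rewrite ltr_norml => /andP[yx _]; rewrite /flat.
    by case: ltP => //; lra.
  have dV : is_derive x (1 : R) (fun y => y^-1) (- x ^- 2).
    apply: is_derive_eq (is_deriveV _ (is_derive_id x (1 : R))) _.
      by rewrite gt_eqF.
    by rewrite /GRing.scale /= mulr1.
  have dp := @is_derive1_comp R (horner (flat_poly k)) _ x _ _ (is_derive_poly _ _) dV.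
  have dN : is_derive x (1 : R) (fun y => - y^-1) (x ^- 2).
    by apply: is_derive_ext (is_derive_eq (is_derive_scale (-1) dV) _) => [y|]; ring.
  have de := @is_derive1_comp R expR _ x _ _ (is_derive_expR _) dN.
  apply: is_derive_eq (is_derive_mul dp de) _.
  rewrite /flat x0 /= !hornerE /= exprVn.
  by move: (x ^- 2) (expR _) => s e; ring.
- rewrite flat_le0//; apply/is_derive_epsP => eps e0.
  (* With t = 1/y this bounds [flat k y] by C y^2, hence a zero derivative at 0. *)
  have [C C0 H] := horner_le_expR (flat_poly k) 2.
  exists (eps / C) => [|y]; first by rewrite divr_gt0.
  rewrite !subr0 mul0r (flat_le0 _ (lexx 0)) !subr0 => yd.
  have [y0|y0] := leP y 0; first by rewrite flat_le0// normr0 mulr_ge0// ltW.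
  have := H y^-1; rewrite invr_ge0 ltW// => /(_ isT).
  have y2 : 0 <= y ^- 2 by rewrite invr_ge0 exprn_ge0// ltW.
  rewrite exprVn normrM (ger0_norm y2).
  rewrite ler_pdivrMr ?exprn_gt0// => Hy.
  rewrite /flat y0 normrM (ger0_norm (expR_ge0 _)) expRN.
  rewrite ler_pdivrMr ?expR_gt0//; apply: le_trans Hy _.
  rewrite (gtr0_norm y0) in yd *.
  have := yd; rewrite ltr_pdivlMr// => /ltW yd'.
  have yE : 0 <= y * expR y^-1 by rewrite mulr_ge0 ?expR_ge0// ltW.
  have := ler_wpM2r yE yd'.
  by rewrite expr2; lra.
Qed.

(** The normalized primitive of the bump flat(x) flat(1 - x). Its nonnegative derivative [th 1] has
    integral 1 on [0, 1] and serves later as the basic bump. *)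
Lemma step_function : exists th : nat -> R -> R, exists B : nat -> R,
  [/\ jet th, forall k x, x <= 0 -> th k x = 0,
      forall k x, 1 <= x -> th k x = (k == 0%N)%:R,
      forall x, 0 <= th 1%N x & forall k, 0 < B k /\ forall x, `|th k x| <= B k].
Proof.
pose bt := jmul flat (fun k x => (-1) ^+ k * flat k (-1 * x + 1)).
have jb : jet bt := jet_mul flat_jet (jet_affine (-1) 1 flat_jet).
have b0 k x : x <= 0 -> bt k x = 0.
  by move=> x0; rewrite /bt /jmul big1// => i _; rewrite flat_le0//; ring.
have b1 k x : 1 <= x -> bt k x = 0.
  move=> x1; rewrite /bt /jmul big1// => i _.
  by rewrite (flat_le0 _ (x := -1 * x + 1)); [ring|lra].
have bE x : bt 0%N x = flat 0 x * flat 0 (-1 * x + 1).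
  by rewrite /bt /jmul big_ord1 /= bin0 expr0 !mul1r.
have f0 x : 0 <= flat 0 x.
  by rewrite /flat; case: ifP => // _; rewrite hornerE mul1r expR_ge0.
have fp x : 0 < x -> 0 < flat 0 x.
  by move=> x0; rewrite /flat x0 hornerE mul1r expR_gt0.
have bp x : 0 <= bt 0%N x by rewrite bE mulr_ge0.
have [P dP] := continuous_primitive (jet_continuous (k := 0) jb).
have Pmon x y : x <= y -> P x <= P y.
  move=> xy; have [z [_ E]] := MVT_between x y dP.
  by have : 0 <= bt 0%N z * (y - x) by [apply: mulr_ge0; [|lra]]; lra.
have P01 : 0 < P 1 - P 0.
  (* Staying away from 0 and 1 yields an intermediate point where the bump is positive. *)
  have [z [zi E]] := MVT_between (1/4) (3/4) dP.
  have z0 : 0 < z by lra. have z1 : 0 < -1 * z + 1 by lra.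
  have bz : 0 < bt 0%N z.
    by rewrite bE mulr_gt0 ?fp.
  have : P 0 <= P (1/4) by apply: Pmon; lra.
  have : P (3/4) <= P 1 by apply: Pmon; lra.
  by lra.
pose c := P 1 - P 0.
pose th k x := if k is j.+1 then bt j x / c else (P x - P 0) / c.
have th0 k x : x <= 0 -> th k x = 0.
  move=> x0; case: k => [|k] /=; last by rewrite b0 ?mul0r.
  have [z [zi ->]] := MVT_between 0 x dP.
  by rewrite b0 ?mul0r//; lra.
have th1 k x : 1 <= x -> th k x = (k == 0%N)%:R.
  move=> x1; case: k => [|k] /=; last by rewrite b1 ?mul0r.
  have [z [zi E]] := MVT_between 1 x dP.
  have -> : P x = P 1 by move: E; rewrite b1 ?mul0r; lra.
  by rewrite divff// gt_eqF.
have jth : jet th.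
  case=> [|k] x /=.
    apply: is_derive_ext (is_derive_eq (is_derive_scale c^-1
      (is_derive_sub (dP x) (is_derive_const x (P 0)))) _) => [y|].
      by rewrite mulrC.
    by rewrite subr0 mulrC.
  apply: is_derive_ext (is_derive_eq (is_derive_scale c^-1 (jb k x)) _) => [y|].
    by rewrite mulrC.
  by rewrite mulrC.
have /choice[B BE] : forall k, exists B : R, 0 < B /\ forall x, `|th k x| <= B.
  move=> k; have [M M0 HM] := jet_bounded k 0 1 jth.
  exists (M + 1); split=> [|x]; first lra.
  have [x0|x0] := leP x 0; first by rewrite th0// normr0; lra.
  have [x1|x1] := leP 1 x.
    by rewrite th1//; case: (k == 0%N); rewrite ?normr0 ?normr1; lra.
  have := HM x; lra.
exists th, B; split=> //.
move=> x; apply: divr_ge0; [exact: bp|exact: ltW].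
Qed.

End Step.

(** * Borel's theorem with uniform bounds *)

Section Borel.
Variable R : realType.
Implicit Types (x y : R) (k n : nat).

(** Take 1 - th(x) - th(-x). It need not be constant near 0: since th is flat at 0, its jet there is
    that of the constant 1, which is all that Borel's construction uses. *)
Lemma cutoff_function : exists chi : nat -> R -> R, exists B : nat -> R,
  [/\ jet chi, forall k x, 1 <= `|x| -> chi k x = 0,
      forall k, chi k 0 = (k == 0%N)%:R &
      forall k, 0 < B k /\ forall x, `|chi k x| <= B k].
Proof.
have [th [B [jt t0 t1 _ BE]]] := step_function R.
exists (fun k x => (if k is 0 then 1 else 0) - th k x - (-1) ^+ k * th k (-1 * x + 0)).
exists (fun k => 1 + B k + B k); split.
- exact: jet_sub (jet_sub (jet_const 1) jt) (jet_affine (-1) 0 jt).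
- move=> k x; rewrite mulN1r addr0.
  have [x0|x0] := leP 0 x.
    rewrite (ger0_norm x0) => x1.
    by rewrite t1// t0 ?oppr_le0//; case: k => [|k] /=; ring.
  rewrite (ltr0_norm x0) => x1; rewrite (t0 _ x) ?ltW// t1//.
  by case: k => [|k] /=; rewrite ?expr0; ring.
- by move=> k; rewrite mulr0 addr0 t0//; case: k => [|k] /=; ring.
- move=> k; have [B0 HB] := BE k; split=> [|x]; first lra.
  rewrite (le_trans (ler_normB _ _))// lerD//; last first.
    by rewrite normrM normrX normrN1 expr1n mul1r.
  rewrite (le_trans (ler_normB _ _))// lerD//.
  by case: k {B0 HB} => [|k]; rewrite ?normr0 ?normr1.
Qed.

(** The k-th derivative of x^n chi(x): Leibniz with the linear factor x leaves two terms, and at k =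
    0 the factor [k%:R] removes the one where [k.-1] is truncated. *)
Fixpoint cut_monomial (chi : nat -> R -> R) n k x : R :=
  if n is m.+1
  then x * cut_monomial chi m k x + k%:R * cut_monomial chi m k.-1 x
  else chi k x.

Lemma cut_monomial_jet chi n : jet chi -> jet (cut_monomial chi n).
Proof.
move=> jc; elim: n => [|n IH] //= k x.
have d1 := is_derive_mul (is_derive_id x (1 : R)) (IH k x).
case: k d1 => [|k] d1 /=.
  apply: is_derive_ext (is_derive_eq d1 _) => [y|]; rewrite /=; ring.
have d2 := is_derive_scale k.+1%:R (IH k x).
apply: is_derive_eq (is_derive_add d1 d2) _.
by rewrite -[k.+2%:R]natr1; ring.
Qed.

Lemma cut_monomial_eq0 chi n k x : 1 <= `|x| ->
  (forall k x, 1 <= `|x| -> chi k x = 0) -> cut_monomial chi n k x = 0.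
Proof.
move=> x1 c0; elim: n k => [|n IH] k /=; first exact: c0.
by rewrite !IH; ring.
Qed.

Lemma cut_monomial_at0 chi n k : (forall k, chi k 0 = (k == 0%N)%:R) ->
  cut_monomial chi n k 0 = if k == n then n`!%:R else 0.
Proof.
move=> c0; elim: n k => [|n IH] k /=; first by rewrite c0; case: eqP.
rewrite mul0r add0r IH; case: k => [|k]; first by rewrite mul0r.
rewrite eqSS /=; case: eqP => [->|_]; last by rewrite mulr0.
by rewrite factS natrM.
Qed.

Lemma cut_monomial_bounded chi n k : jet chi ->
  (forall k x, 1 <= `|x| -> chi k x = 0) ->
  exists2 M : R, 0 < M & forall x, `|cut_monomial chi n k x| <= M.
Proof.
move=> jc c0; have [M M0 HM] := jet_bounded k (-1) 1 (cut_monomial_jet n jc).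
exists M => // x; have [x1|x1] := leP 1 `|x|.
  by rewrite cut_monomial_eq0// normr0 ltW.
by apply: HM; rewrite -ler_norml ltW.
Qed.

(** The series of c_n/n! x^n chi(r_n x). The scales r_n are computed from the bounds M and not from
    c, which makes B the same for all c. *)
Lemma borel_uniform (M : nat -> R) : (forall k, 0 <= M k) ->
  exists B : nat -> R, forall c : nat -> R, (forall k, `|c k| <= M k) ->
  exists u : nat -> R -> R,
    [/\ jet u, forall k x, `|u k x| <= B k & forall k, u k 0 = c k].
Proof.
move=> M0; have [chi [_ [jc c1 c0 _]]] := cutoff_function.
pose w := cut_monomial chi.
have /choice[W WE] : forall n, exists W : nat -> R,
    forall k, 0 < W k /\ forall x, `|w n k x| <= W k.
  move=> n; have /choice[W WE] : forall k, exists W : R,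
    0 < W /\ forall x, `|w n k x| <= W.
    by move=> k; have [C C0 HC] := cut_monomial_bounded n k jc c1; exists C.
  by exists W.
(* For k < n the k-th derivative of term n is at most M_n W_nk r_n^(k-n), hence at most M_n W_nk /
   r_n, and this choice brings it below 2^-n. *)
pose r n : R := 1 + 2 ^+ n * M n * \sum_(k < n) W n k.
have W0 n k : 0 <= W n k by rewrite ltW// (WE n k).1.
have r1 n : 1 <= r n by rewrite lerDl !mulr_ge0 ?exprn_ge0// sumr_ge0.
have r0 n : 0 < r n by apply: lt_le_trans (r1 n).
have rge n : 0 <= r n by exact: ltW.
have rkge n k : 0 <= r n ^+ k by rewrite exprn_ge0.
(* Bounds the finitely many terms n <= k that the choice of r does not make small; the 2 in [B] is
   the sum of the geometric series. *)
pose A k n : R := if (n <= k)%N then M n * (r n ^+ k * W n k) else 0.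
have A0 k n : 0 <= A k n.
  by rewrite /A; case: ifP => // _; rewrite !mulr_ge0.
pose B k : R := \sum_(n < k.+1) A k n + 2.
exists B => c cM.
pose t n k x := c n / n`!%:R / r n ^+ n * (r n ^+ k * w n k (r n * x + 0)).
have jt n : jet (t n) by exact: jet_scale (jet_affine _ _ (cut_monomial_jet n jc)).
have fn (n : nat) : 1 <= n`!%:R :> R by rewrite ler1n fact_gt0.
have tle n k x : `|t n k x| <= A k n + 2^-1 ^+ n.
  have rk : `|r n ^+ k * w n k (r n * x + 0)| <= r n ^+ k * W n k.
    by rewrite normrM ger0_norm// ler_wpM2l//; exact: (WE n k).2.
  have cn : `|c n / n`!%:R| <= M n.
    rewrite normrM normfV (ger0_norm (x := n`!%:R))// ler_pdivrMr; last first.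
      by apply: lt_le_trans (fn n).
    by rewrite (le_trans (cM n))// ler_peMr.
  have rnn : 1 <= r n ^+ n by rewrite exprn_ege1.
  rewrite normrM normrM normfV (ger0_norm (x := r n ^+ n))//.
  rewrite /A; case: leqP => [nk|kn].
    apply: ler_wpDr; first by rewrite exprn_ge0// invr_ge0.
    rewrite ler_pM// ?divr_ge0//.
    by rewrite ler_pdivrMr ?exprn_gt0// (le_trans cn)// ler_peMr.
  rewrite add0r exprVn.
  have : `|c n / n`!%:R| * `|r n ^+ k * w n k (r n * x + 0)| <=
      M n * (r n ^+ k * W n k) by rewrite ler_pM.
  rewrite mulrAC => /le_trans H; rewrite ler_pdivrMr ?exprn_gt0//.
  apply: H; rewrite [leRHS]mulrC ler_pdivlMr ?exprn_gt0//.
  have Wk : W n k <= \sum_(j < n) W n j.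
    by rewrite (bigD1 (Ordinal kn))//= lerDl sumr_ge0.
  apply: (@le_trans _ _ (r n ^+ k * r n)); last first.
    by rewrite -exprSr ler_weXn2l.
  rewrite -!mulrA mulrCA ler_wpM2l//.
  rewrite /r mulrCA [2 ^+ n * _]mulrC mulrCA.
  have : 2 ^+ n * M n * W n k <= 2 ^+ n * M n * \sum_(j < n) W n j.
    by rewrite ler_wpM2l// mulr_ge0// exprn_ge0.
  by lra.
pose S N k x := \sum_(n < N) t n k x.
have SA N k x : \sum_(n < N) `|t n k x| <= B k.
  apply: (@le_trans _ _ (\sum_(n < N) (A k n + 2^-1 ^+ n))).
    by apply: ler_sum => n _; exact: tle.
  rewrite big_split /= lerD//.
    apply: (@le_trans _ _ (\sum_(n < N + k.+1) A k n)).
      by rewrite big_split_ord /= lerDl sumr_ge0.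
    rewrite addnC big_split_ord /= gerDl big1// => i _.
    by rewrite /A leqNgt leq_addr.
  have := subrXX 1 (2^-1 : R) N.
  have -> : \sum_(i < N) (1 : R) ^+ (N.-1 - i) * 2^-1 ^+ i = \sum_(i < N) 2^-1 ^+ i.
    by apply: eq_bigr => i _; rewrite expr1n mul1r.
  rewrite expr1n; have : 0 <= (2^-1 : R) ^+ N by rewrite exprn_ge0// invr_ge0.
  lra.
have SB N k x : `|S N k x| <= B k.
  exact: le_trans (ler_norm_sum _ _ _) (SA N k x).
have cS k x : cvgn (fun N => S N k x).
  have -> : (fun N => S N k x) = series (fun n => t n k x).
    by apply/funext => N; rewrite /series /= big_mkord.
  apply: normed_cvg.
  have -> : [normed series (fun n => t n k x)] = fun N => \sum_(n < N) `|t n k x|.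
    by apply/funext => N; rewrite /= seriesEord.
  apply: nondecreasing_is_cvgn; last by exists (B k) => _ [N _ <-].
  by apply/nondecreasing_seqP => N; rewrite big_ord_recr /= lerDl.
have [ju uB] := jet_limit (fun N => jet_sum N jt) SB cS.
exists (fun k x => limn (fun N => S N k x)); split => // k.
(* At 0 only the term n = k has a nonzero k-th derivative, so the partial sums are eventually
   constant. *)
have St N : (k < N)%N -> S N k 0 = c k.
  move=> kN; rewrite /S (bigD1 (Ordinal kN))//= big1 ?addr0.
    rewrite /t mulr0 addr0 /w cut_monomial_at0// eqxx.
    by rewrite mulrA divfK ?gt_eqF ?exprn_gt0// divfK// gt_eqF// (lt_le_trans _ (fn k)).
  move=> i; rewrite -val_eqE /= => ik; rewrite /t mulr0 addr0 /w cut_monomial_at0//.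
  by rewrite eq_sym (negbTE ik) !mulr0.
apply: cvg_lim; first exact: norm_hausdorff.
apply/cvgrPdist_le => e e0; exists k.+1 => // N /= kN.
by rewrite St// subrr normr0 ltW.
Qed.

End Borel.

(** * Gluing along a closed set *)

Section Gluing.
Variable R : realType.
Implicit Types (E A : set R) (x y a b c : R) (F : nat -> R -> R).

Definition gap E a b := [/\ E a, E b, a < b & forall x, a < x < b -> ~ E x].

Lemma closed_has_ball E x : closed E -> ~ E x ->
  exists2 d : R, 0 < d & forall y, `|y - x| < d -> ~ E y.
Proof.
move=> cE nEx; have : open (~` E) by rewrite openC.
rewrite openE => /(_ x nEx) /nbhs_ballP[d /= d0 H]; exists d => // y yx.
by apply: H; rewrite /ball /= distrC.
Qed.

Lemma closed_sup_mem A : closed A -> has_sup A -> A (sup A).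
Proof.
move=> cA sA; apply: contrapT => /(closed_has_ball cA)[d d0 H].
have [y Ay yd] := sup_adherent d0 sA.
apply: (H y _ Ay); rewrite ltr_norml.
by have := sup_upper_bound sA Ay; lra.
Qed.

Lemma closed_inf_mem A : closed A -> has_inf A -> A (inf A).
Proof.
move=> cA sA; apply: contrapT => /(closed_has_ball cA)[d d0 H].
have [y Ay yd] := inf_adherent d0 sA.
apply: (H y _ Ay); rewrite ltr_norml.
by have := ge_inf sA.2 Ay; lra.
Qed.

Lemma last_before E x : closed E -> (exists2 e, E e & e <= x) ->
  exists a, [/\ E a, a <= x & forall y, E y -> y <= x -> y <= a].
Proof.
move=> cE [e Ee ex]; pose A := E `&` [set y | y <= x].
have sA : has_sup A by split; [exists e|exists x => y []].
have [|Es sx] := closed_sup_mem _ sA; first by apply: closedI => //; exact: closed_le.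
by exists (sup A); split=> // y Ey yx; apply: (sup_upper_bound sA).
Qed.

Lemma first_after E x : closed E -> (exists2 e, E e & x <= e) ->
  exists b, [/\ E b, x <= b & forall y, E y -> x <= y -> b <= y].
Proof.
move=> cE [e Ee ex]; pose A := E `&` [set y | x <= y].
have sA : has_inf A by split; [exists e|exists x => y []].
have [|Es sx] := closed_inf_mem _ sA; first by apply: closedI => //; exact: closed_ge.
by exists (inf A); split=> // y Ey yx; apply: (ge_inf sA.2).
Qed.

Lemma gap_exists E x : closed E -> ~ E x ->
  (exists2 e, E e & e <= x) -> (exists2 e, E e & x <= e) ->
  exists a b, gap E a b /\ a < x < b.
Proof.
move=> cE nEx /(last_before cE)[a [Ea ax aP]] /(first_after cE)[b [Eb xb bP]].
have ax' : a < x by case: (ltgtP a x) ax => // aEx _; rewrite aEx in Ea.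
have xb' : x < b by case: (ltgtP x b) xb => // xEb _; rewrite -xEb in Eb.
exists a, b; rewrite ax' xb'; split=> //; split=> //; first exact: lt_trans xb'.
move=> y yab Ey; have [yx|/ltW xy] := leP y x.
  by have := aP _ Ey yx; lra.
by have := bP _ Ey xy; lra.
Qed.

Lemma gap_right E x : closed E -> E x -> (exists2 e, E e & x < e) ->
  (exists b, gap E x b) \/
  (forall d : R, 0 < d -> exists2 y, E y & x < y < x + d).
Proof.
move=> cE Ex [e Ee xe]; have [|/existsNP[d /not_implyP[d0 nE]]] :=
  pselect (forall d : R, 0 < d -> exists2 y, E y & x < y < x + d); [by right|left].
have nE' y : E y -> x < y -> x + d <= y.
  by move=> Ey xy; rewrite leNgt; apply/negP => yd; apply: nE; exists y; rewrite ?xy.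
have [|b [Eb xb bP]] := @first_after E (x + d) cE; first by exists e => //; exact: nE'.
exists b; split=> //; first lra.
move=> y /andP[xy yb] Ey; have := bP _ Ey (nE' _ Ey xy); lra.
Qed.

Lemma gap_left E x : closed E -> E x -> (exists2 e, E e & e < x) ->
  (exists a, gap E a x) \/
  (forall d : R, 0 < d -> exists2 y, E y & x - d < y < x).
Proof.
move=> cE Ex [e Ee xe]; have [|/existsNP[d /not_implyP[d0 nE]]] :=
  pselect (forall d : R, 0 < d -> exists2 y, E y & x - d < y < x); [by right|left].
have nE' y : E y -> y < x -> y <= x - d.
  by move=> Ey xy; rewrite leNgt; apply/negP => yd; apply: nE; exists y; rewrite ?yd.
have [|b [Eb xb bP]] := @last_before E (x - d) cE; first by exists e => //; exact: nE'.
exists b; split=> //; first lra.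
move=> y /andP[by' yx] Ey; have := bP _ Ey (nE' _ Ey yx); lra.
Qed.

Lemma gap_out E a b x : gap E a b -> E x -> x <= a \/ b <= x.
Proof.
move=> [_ _ ab H] Ex; have [|ax] := leP x a; [by left|right].
by rewrite leNgt; apply/negP => xb; apply: (H x) => //; rewrite ax.
Qed.

Lemma gap_unique E a b c d x : gap E a b -> gap E c d ->
  a < x < b -> c < x < d -> a = c /\ b = d.
Proof.
move=> g g' xab xcd; have [Ea Eb _ _] := g; have [Ec Ed _ _] := g'.
have := gap_out g Ec; have := gap_out g Ed.
have := gap_out g' Ea; have := gap_out g' Eb.
move=> [?|?] [?|?] [?|?] [?|?]; split; lra.
Qed.

(** Along E, each F k has derivative F k.+1. This first order consequence of Taylor estimates is
    what gluing asks of the field. *)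
Definition whitney_differentiable E F :=
  forall k x, E x -> forall eps : R, 0 < eps -> exists2 delta : R, 0 < delta &
    forall y, E y -> `|y - x| < delta ->
      `|F k y - F k x - F k.+1 x * (y - x)| <= eps * `|y - x|.

Lemma whitney_differentiable_cont E F k x : whitney_differentiable E F -> E x ->
  forall eps : R, 0 < eps -> exists2 delta : R, 0 < delta &
    forall y, E y -> `|y - x| < delta -> `|F k y - F k x| <= eps.
Proof.
move=> W Ex eps e0; have [d d0 H] := W k x Ex 1 ltr01.
pose C := `|F k.+1 x| + 1; have C0 : 0 < C by rewrite ltr_wpDl.
exists (Num.min d (eps / C)) => [|y Ey]; first by rewrite lt_min d0 divr_gt0.
rewrite lt_min => /andP[yd]; rewrite ltr_pdivlMr// => yC.
have := H y Ey yd.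
have : `|F k.+1 x * (y - x)| = `|F k.+1 x| * `|y - x| by rewrite normrM.
have := ler_normD (F k y - F k x - F k.+1 x * (y - x)) (F k.+1 x * (y - x)).
rewrite subrK; move: yC; rewrite /C mulrDr; lra.
Qed.

(** Goes from x to the gap endpoint c along the field, then from c to y inside the gap by the mean
    value theorem. The hypothesis on distances says that c lies between x and y. *)
Lemma gap_increment F (v : nat -> R -> R) k x a b c y (e : R) : jet v ->
  a <= y <= b -> a <= c <= b -> v k c = F k c ->
  (forall z, a <= z <= b -> `|v k.+1 z - F k.+1 a| <= e) ->
  `|F k.+1 a - F k.+1 x| <= e ->
  `|F k c - F k x - F k.+1 x * (c - x)| <= e * `|c - x| ->
  `|y - c| + `|c - x| = `|y - x| ->
  `|v k y - F k x - F k.+1 x * (y - x)| <= 2 * e * `|y - x|.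
Proof.
move=> jv yab cab vc vs Fa Fc eyx.
have [z [zc E1]] := MVT_between c y (jv k).
have : `|v k.+1 z - F k.+1 x| <= 2 * e.
  rewrite (_ : _ - _ = (v k.+1 z - F k.+1 a) + (F k.+1 a - F k.+1 x)); last ring.
  rewrite (le_trans (ler_normD _ _))//.
  have : a <= z <= b by case/orP: zc; lra.
  by move=> /vs; lra.
move=> Hz.
have -> : v k y - F k x - F k.+1 x * (y - x) =
    (v k.+1 z - F k.+1 x) * (y - c) + (F k c - F k x - F k.+1 x * (c - x)).
  by rewrite -vc mulrBl -E1; ring.
rewrite (le_trans (ler_normD _ _))// normrM -eyx.
have e0 : 0 <= e by apply: le_trans Fa.
have := ler_wpM2r (normr_ge0 (y - c)) Hz.
have := mulr_ge0 e0 (normr_ge0 (c - x)).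
by lra.
Qed.

(** Only differentiability at points x of E is at stake, one side at a time. If a gap starts at x,
    its own jet decides. Otherwise E accumulates at x, so nearby gaps are short and the smallness
    hypothesis, applied to the next derivative, controls them. *)
Lemma glue_jets E F (u : R -> R -> nat -> R -> R) : closed E ->
  (forall x, exists2 e, E e & e < x) -> (forall x, exists2 e, E e & x < e) ->
  whitney_differentiable E F ->
  (forall a b, gap E a b ->
    [/\ jet (u a b), forall k, u a b k a = F k a & forall k, u a b k b = F k b]) ->
  (forall k (eps : R), 0 < eps -> exists2 delta : R, 0 < delta &
    forall a b, gap E a b -> b - a < delta ->
      forall x, a <= x <= b -> `|u a b k x - F k a| <= eps) ->
  exists U : nat -> R -> R,
    [/\ jet U, forall k x, E x -> U k x = F k x &
      forall a b k x, gap E a b -> a <= x <= b -> U k x = u a b k x].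
Proof.
move=> cE El Er W ug us.
have /choice[p pP] : forall x, exists p : R * R,
    ~ E x -> gap E p.1 p.2 /\ p.1 < x < p.2.
  move=> x; have [Ex|nEx] := pselect (E x); first by exists (0, 0).
  have [||a [b H]] := @gap_exists E x cE nEx.
  - by have [e Ee ex] := El x; exists e => //; exact: ltW.
  - by have [e Ee ex] := Er x; exists e => //; exact: ltW.
  by exists (a, b).
pose U k x := if `[< E x >] then F k x else u (p x).1 (p x).2 k x.
have UE k x : E x -> U k x = F k x by move=> Ex; rewrite /U asboolT.
have Ug a b k x : gap E a b -> a <= x <= b -> U k x = u a b k x.
  move=> g xab; have [_ ua ub] := ug _ _ g.
  have [Ex|nEx] := pselect (E x).
    rewrite UE//; have [xa|bx] := gap_out g Ex.
      by rewrite (_ : x = a) ?ua//; lra.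
    by rewrite (_ : x = b) ?ub//; lra.
  rewrite /U asboolF//; have [g' xp] := pP _ nEx.
  have [Ea Eb _ _] := g.
  have xab' : a < x < b.
    case/andP: xab => ax xb; apply/andP; split.
      by case: (ltgtP a x) ax => // aEx _; rewrite -aEx in nEx.
    by case: (ltgtP x b) xb => // xEb _; rewrite xEb in nEx.
  by have [<- <-] := gap_unique g' g xp xab'.
exists U; split=> // k x.
have [Ex|nEx] := pselect (E x); last first.
  have [g xp] := pP _ nEx; set a := (p x).1 in g xp; set b := (p x).2 in g xp.
  have [ju _ _] := ug _ _ g; rewrite (Ug a b)//; last lra.
  have d0 : 0 < Num.min (x - a) (b - x) by rewrite lt_min; lra.
  apply: (is_derive_near d0) (ju k x) => y.
  by rewrite lt_min !ltr_norml => yx; rewrite (Ug a b)//; lra.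
have [] : (forall eps : R, 0 < eps -> exists2 d : R, 0 < d & forall y, x <= y < x + d ->
      `|U k y - F k x - F k.+1 x * (y - x)| <= eps * `|y - x|) /\
   (forall eps : R, 0 < eps -> exists2 d : R, 0 < d & forall y, x - d < y <= x ->
      `|U k y - F k x - F k.+1 x * (y - x)| <= eps * `|y - x|); last first.
  move=> HR HL; apply/is_derive_epsP => eps e0; rewrite !UE//.
  have [d1 d10 H1] := HR _ e0; have [d2 d20 H2] := HL _ e0.
  exists (Num.min d1 d2) => [|y]; first by rewrite lt_min d10.
  rewrite lt_min !ltr_norml => yx; have [xy|/ltW yx'] := leP x y.
    by apply: H1; lra.
  by apply: H2; lra.
have key (eps : R) : 0 < eps -> exists2 d : R, 0 < d &
    (forall y, E y -> `|y - x| < d ->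
      `|F k y - F k x - F k.+1 x * (y - x)| <= eps * `|y - x|) /\
    forall a b c y, gap E a b -> b - a < d -> `|a - x| < d ->
      a <= y <= b -> (c = a \/ c = b) -> `|c - x| < d ->
      `|y - c| + `|c - x| = `|y - x| ->
      `|U k y - F k x - F k.+1 x * (y - x)| <= eps * `|y - x|.
  move=> e0; have e2 : 0 < eps / 2 by rewrite divr_gt0.
  have [d1 d10 H1] := W k x Ex _ e2.
  have [d2 d20 H2] := us k.+1 _ e2.
  have [d3 d30 H3] := whitney_differentiable_cont k.+1 W Ex e2.
  exists (Num.min d1 (Num.min d2 d3)) => [|].
    by rewrite !lt_min d10 d20.
  split; first move=> y Ey.
    rewrite lt_min => /andP[/(H1 _ Ey)]; have := normr_ge0 (y - x); nra.
  move=> a b c y g; rewrite !lt_min => /and3P[_ ba _] /and3P[_ _ ax] yab cab /andP[cx _] eyx.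
  have [ju ua ub] := ug _ _ g; have [Ea Eb ab _] := g.
  rewrite (Ug a b)//.
  suff : `|u a b k y - F k x - F k.+1 x * (y - x)| <= 2 * (eps / 2) * `|y - x|.
    by lra.
  have Ec : E c by case: cab => ->.
  apply: (gap_increment (c := c) ju yab) => //.
  - by case: cab => ->; lra.
  - by case: cab => ->.
  - by move=> z zab; exact: H2.
  - exact: H3.
  - exact: H1.
split=> eps e0.
- have [[b g]|acc] := gap_right cE Ex (Er x).
    have [ju ux _] := ug _ _ g; have [_ _ xb _] := g.
    have /is_derive_epsP/(_ _ e0)[d d0 H] := ju k x.
    exists (Num.min d (b - x)) => [|y]; first by rewrite lt_min d0; lra.
    move=> /andP[xy yd]; have : y - x < Num.min d (b - x) by lra.
    rewrite lt_min => /andP[y1 y2].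
    rewrite (Ug x b)//; last lra.
    by rewrite -!ux; apply: H; rewrite ger0_norm; lra.
  (* No gap crosses x or y0, so every gap meeting the interval between them is shorter than d. *)
  have [d d0 [H1 H2]] := key _ e0; have [y0 Ey0 y0x] := acc _ d0.
  exists (y0 - x) => [|y xy]; first lra.
  have [Ey|nEy] := pselect (E y).
    by rewrite UE//; apply: H1 => //; rewrite ger0_norm; lra.
  have [g yp] := pP _ nEy; set a := (p y).1 in g yp; set b := (p y).2 in g yp.
  have ax : x <= a by case: (gap_out g Ex); lra.
  have by0 : b <= y0 by case: (gap_out g Ey0); lra.
  apply: (H2 a b a y) => //; try lra; try by left.
  + by rewrite ger0_norm; lra.
  + by rewrite ger0_norm; lra.
  + by rewrite !ger0_norm; lra.
- have [[b g]|acc] := gap_left cE Ex (El x).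
    have [ju _ ux] := ug _ _ g; have [_ _ xb _] := g.
    have /is_derive_epsP/(_ _ e0)[d d0 H] := ju k x.
    exists (Num.min d (x - b)) => [|y]; first by rewrite lt_min d0; lra.
    move=> /andP[yd xy]; have : x - y < Num.min d (x - b) by lra.
    rewrite lt_min => /andP[y1 y2].
    rewrite (Ug b x)//; last lra.
    by rewrite -!ux; apply: H; rewrite ler0_norm; lra.
  have [d d0 [H1 H2]] := key _ e0; have [y0 Ey0 y0x] := acc _ d0.
  exists (x - y0) => [|y xy]; first lra.
  have [Ey|nEy] := pselect (E y).
    by rewrite UE//; apply: H1 => //; rewrite ler0_norm; lra.
  have [g yp] := pP _ nEy; set a := (p y).1 in g yp; set b := (p y).2 in g yp.
  have ax : b <= x by case: (gap_out g Ex); lra.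
  have by0 : y0 <= a by case: (gap_out g Ey0); lra.
  apply: (H2 a b b y) => //; try lra; try by right.
  + by rewrite ler0_norm; lra.
  + by rewrite ler0_norm; lra.
  + by rewrite !ler0_norm; lra.
Qed.

End Gluing.

(** * The smooth Whitney extension *)

Section WhitneyExtension.
Variable R : realType.
Implicit Types (E : set R) (x y a b : R) (F : nat -> R -> R).

(* A single constant serves both as the factor and as the inverse of the
   radius, so that finitely many such bounds are merged by adding constants. *)
Definition taylor_field E F := forall k n, exists2 C : R, 0 < C &
  forall a b, E a -> E b -> C * `|b - a| < 1 ->
    `|F k b - \sum_(l < n) F (k + l)%N a / l`!%:R * (b - a) ^+ l|
      <= C * `|b - a| ^+ n.

Lemma taylor_field_differentiable E F :
  taylor_field E F -> whitney_differentiable E F.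
Proof.
move=> T k x Ex eps e0; have [C C0 H] := T k 2%N.
exists (Num.min C^-1 (eps / C)) => [|y Ey].
  by rewrite lt_min invr_gt0 C0 divr_gt0.
rewrite lt_min ltr_pdivlMr// mulrC => /andP[y1 y2].
have := H x y Ex Ey; rewrite -ltr_pdivlMl// mulr1 => /(_ y1).
rewrite !big_ord_recl big_ord0 /= /bump /= addn0 addn1 fact0.
rewrite (_ : 1`! = 1)%N// !divr1 expr0 expr1 mulr1 addr0 opprD addrA.
move=> /le_trans; apply; rewrite expr2 mulrA ler_wpM2r//.
by rewrite ltW.
Qed.

Section Extension.
Variables (E : set R) (F U : nat -> R -> R) (V : R -> nat -> R -> R).
Variable B : nat -> R.
Hypothesis TF : taylor_field E F.
Hypothesis jV : forall a, E a -> jet (V a).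
Hypothesis VB : forall a k x, E a -> `|V a k x| <= B k.
Hypothesis VF : forall a k, E a -> V a k a = F k a.

(** At b, both functions are compared with the Taylor polynomial of the field at a: [V b] takes the
    value of F there, and [V a] has the same jet at a. *)
Lemma jet_family_endpoint j n : exists2 C : R, 0 < C &
  forall a b, E a -> E b -> a < b -> C * (b - a) < 1 ->
    `|V b j b - V a j b| <= C * (b - a) ^+ n.
Proof.
have [C C0 H] := TF j n; exists (C + `|B (j + n)%N|) => [|a b Ea Eb ab].
  by rewrite ltr_wpDr.
have ab0 : 0 < b - a by lra.
rewrite mulrDl => d1.
have Bp : 0 <= `|B (j + n)%N| * (b - a) by rewrite mulr_ge0// ltW.
have d2 : C * (b - a) < 1 by lra.
have := @taylor_bound R (fun k => V a (j + k)%N) n a b (B (j + n)%N)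
   (jet_shift j (jV Ea)) (fun x _ => VB _ _ Ea).
rewrite addn0; set T := \sum_(l < n) _.
have -> : T = \sum_(l < n) F (j + l)%N a / l`!%:R * (b - a) ^+ l.
  by apply: eq_bigr => i _; rewrite VF.
have := H a b Ea Eb; rewrite (gtr0_norm ab0) => /(_ d2) {T}.
set T := \sum_(l < n) _ => H1 H2.
rewrite VF// (_ : _ - _ = (F j b - T) - (V a j b - T)); last ring.
rewrite (le_trans (ler_normB _ _))// mulrDl lerD// (le_trans H2)//.
by rewrite ler_wpM2r ?ler_norm// exprn_ge0// ltW.
Qed.

(** Induction on n for all j at once: integrate the estimate of order n for the next derivative,
    starting from b, where the previous lemma gives any order. *)
Lemma jet_family_flat n j : exists2 C : R, 0 < C &
  forall a b, E a -> E b -> a < b -> C * (b - a) < 1 ->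
    forall x, a <= x <= b -> `|V b j x - V a j x| <= C * (b - a) ^+ n.
Proof.
elim: n j => [|n IH] j.
  exists (`|B j| + `|B j| + 1) => [|a b Ea Eb ab _ x _].
    by have := normr_ge0 (B j); lra.
  have := ler_normB (V b j x) (V a j x); have := ler_norm (B j).
  by have := VB j x Ea; have := VB j x Eb; rewrite expr0; lra.
have [C1 C10 H1] := jet_family_endpoint j n.+1; have [C2 C20 H2] := IH j.+1.
exists (C1 + C2) => [|a b Ea Eb ab]; first by rewrite addr_gt0.
have ab0 : 0 < b - a by lra.
have p1 : 0 < C1 * (b - a) by rewrite mulr_gt0.
have p2 : 0 < C2 * (b - a) by rewrite mulr_gt0.
rewrite mulrDl => d x xab.
have h1 : C1 * (b - a) < 1 by lra.
have h2 : C2 * (b - a) < 1 by lra.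
have h3 z : (b <= z <= x) || (x <= z <= b) ->
    `|V b j.+1 z - V a j.+1 z| <= C2 * (b - a) ^+ n.
  by move=> zx; apply: H2 => //; case/orP: zx; lra.
have mv := ler_mvt (jet_sub (jV Eb) (jV Ea) j) h3.
rewrite (_ : _ - _ = (V b j b - V a j b) +
  ((V b j x - V a j x) - (V b j b - V a j b))); last ring.
rewrite (le_trans (ler_normD _ _))// mulrDl lerD//; first exact: H1.
apply: le_trans mv _; rewrite exprSr mulrA ler_wpM2l//.
  by rewrite mulr_ge0 ?exprn_ge0// ltW.
by rewrite ler0_norm; lra.
Qed.

End Extension.

(** Blending across a gap costs [(b - a)^-i] for the i-th derivative of the rescaled step. This is
    affordable because the two blended functions differ by any power of b - a. *)
Lemma whitney_extension E F : closed E ->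
  (forall x, exists2 e, E e & e < x) -> (forall x, exists2 e, E e & x < e) ->
  (forall k, exists M, forall x, E x -> `|F k x| <= M) -> taylor_field E F ->
  exists2 U, jet U & forall k x, E x -> U k x = F k x.
Proof.
move=> cE El Er /choice[M ME] TF.
have M0 k : 0 <= M k.
  by have [e Ee _] := El 0; exact: le_trans (ME k _ Ee).
have [B HB] := borel_uniform M0.
have /choice[V VE] : forall a, exists V : nat -> R -> R, E a ->
    [/\ jet V, forall k x, `|V k x| <= B k & forall k, V k a = F k a].
  move=> a; have [Ea|nEa] := pselect (E a); last by exists (fun _ _ => 0).
  have [u [ju uB u0]] := HB (fun k => F k a) (fun k => ME k _ Ea).
  exists (fun k x => 1 ^+ k * u k (1 * x + - a)) => _; split.
  - exact: jet_affine.
  - by move=> k x; rewrite expr1n mul1r.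
  - by move=> k; rewrite expr1n !mul1r subrr.
have jV a : E a -> jet (V a) by move=> /VE[].
have VB a k x : E a -> `|V a k x| <= B k by move=> /VE[].
have VF a k : E a -> V a k a = F k a by move=> /VE[].
have [th [Bt [jt t0 t1 _ BtE]]] := step_function R.
pose Th a b k x := (b - a)^-1 ^+ k * th k ((b - a)^-1 * x + (- a / (b - a))).
pose u a b k x := V a k x + jmul (Th a b) (fun j y => V b j y - V a j y) k x.
have [|||W [jW WF _]] := @glue_jets R E F u cE El Er; last by exists W.
- exact: taylor_field_differentiable.
- move=> a b [Ea Eb ab _]; have ba : b - a != 0 by rewrite subr_eq0 gt_eqF.
  split.
  + apply: jet_add; first exact: jV.
    by apply: jet_mul; [exact: jet_affine|apply: jet_sub; exact: jV].
  + move=> k; rewrite /u VF// /jmul big1 ?addr0// => i _.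
    by rewrite /Th t0 ?mulr0 ?mul0r ?mulr0//; rewrite mulrC -mulrDl subrr mul0r.
  + move=> k; rewrite /u /jmul big_ord_recr /= big1 ?add0r.
      rewrite subnn binn mul1r /Th expr0 mul1r.
      rewrite (_ : _ + _ / _ = 1) ?t1//; last by field.
      by rewrite mul1r VF//; ring.
    move=> i _; rewrite /Th (_ : _ * b + _ = 1); last by field.
    by rewrite t1// subn_eq0 leqNgt ltn_ord /= mulr0 mul0r mulr0.
- move=> k eps e0.
  (* The order is one more than the number k - i of derivatives falling on the step, so that a
     factor b - a survives. *)
  have /choice[C CE] : forall i : 'I_k.+1, exists C : R, 0 < C /\
      forall a b, E a -> E b -> a < b -> C * (b - a) < 1 ->
      forall x, a <= x <= b -> `|V b i x - V a i x| <= C * (b - a) ^+ (k - i).+1.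
    move=> i; have [C C0 HC] := jet_family_flat TF jV VB VF (k - i).+1 i.
    by exists C.
  pose Cs := \sum_(i < k.+1) C i.
  have Cs_ge i : C i <= Cs.
    rewrite /Cs (bigD1 i)//= lerDl sumr_ge0// => j _.
    by rewrite ltW// (CE j).1.
  have Cs0 : 0 < Cs by apply: lt_le_trans (Cs_ge ord0); exact: (CE _).1.
  (* First the variation of [V a] on the gap, then the Leibniz terms of the blend; the 1 makes L
     positive. *)
  pose L := `|B k.+1| + \sum_(i < k.+1) 'C(k, i)%:R * (Bt (k - i)%N * C i) + 1.
  have L0 : 0 < L.
    rewrite ltr_wpDl// addr_ge0// sumr_ge0// => i _.
    by rewrite !mulr_ge0// ltW// ?(BtE _).1// (CE i).1.
  exists (Num.min Cs^-1 (eps / L)) => [|a b [Ea Eb ab _]].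
    by rewrite lt_min invr_gt0 Cs0 divr_gt0.
  have ab0 : 0 < b - a by lra.
  rewrite lt_min ltr_pdivlMr// => /andP[h0 h2] x xab.
  have h1 : Cs * (b - a) < 1 by rewrite -ltr_pdivlMl// mulr1.
  apply: (@le_trans _ _ ((b - a) * L)); last exact: ltW.
  have mv : `|V a k x - F k a| <= `|B k.+1| * (b - a).
    rewrite -(VF _ _ Ea).
    have := @ler_mvt R (V a k) (V a k.+1) (B k.+1) a x (jV _ Ea k)
      (fun z _ => VB _ _ _ Ea).
    move=> /le_trans; apply; rewrite ger0_norm; last lra.
    have := ler_norm (B k.+1); have := normr_ge0 (B k.+1).
    have xa : 0 <= x - a by lra.
    have xb : x - a <= b - a by lra.
    move=> nB Bn; apply: (@le_trans _ _ (`|B k.+1| * (x - a))).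
      by rewrite ler_wpM2r.
    by rewrite ler_wpM2l.
  rewrite /u addrAC (le_trans (ler_normD _ _))// /L mulrDr mulrDr mulr1.
  apply: ler_wpDr; first exact: ltW.
  apply: lerD; first by rewrite mulrC.
  rewrite /jmul (le_trans (ler_norm_sum _ _ _))// mulr_sumr; apply: ler_sum => i _.
  rewrite normrM ger0_norm// mulrCA ler_wpM2l// normrM.
  have Ci := (CE i).2 a b Ea Eb ab _ x xab.
  have h3 : C i * (b - a) < 1.
    apply: le_lt_trans h1; rewrite ler_wpM2r//; first exact: ltW.
  have hT : `|Th a b (k - i)%N x| <= (b - a)^-1 ^+ (k - i) * Bt (k - i)%N.
    rewrite normrM ger0_norm ?exprn_ge0 ?invr_ge0//; last exact: ltW.
    by rewrite ler_wpM2l ?(BtE _).2// exprn_ge0// invr_ge0 ltW.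
  apply: le_trans (ler_pM _ _ hT (Ci h3)) _ => //.
  rewrite exprS exprVn le_eqVlt; apply/orP; left; apply/eqP.
  have : (b - a) ^+ (k - i) != 0 by rewrite expf_neq0// gt_eqF.
  by move: ((b - a) ^+ (k - i)) => z z0; field.
Qed.
End WhitneyExtension.

(** * Area discrepancy and velocity *)

Section Area.
Variable R : realType.
Implicit Types (f g h : nat -> R -> R) (X : R -> R) (a b x : R) (m : nat).

(** X is, up to a constant, half the third coordinate of a horizontal lift of (f, g). *)
Definition area_primitive f g X :=
  forall x, is_derive x (1 : R) X (f 1%N x * g 0%N x - g 1%N x * f 0%N x).

Lemma area_primitive_exists f g : jet f -> jet g -> exists X, area_primitive f g X.
Proof.
move=> jf jg.
have := @continuous_primitive R (fun x => f 1%N x * g 0%N x - g 1%N x * f 0%N x).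
case=> [x|X HX]; last by exists X.
exact: is_derive_continuous (is_derive_sub (is_derive_mul (jf 1%N x) (jg 0%N x))
  (is_derive_mul (jg 1%N x) (jf 0%N x))).
Qed.

Lemma horner_taylor_poly f m a x : (taylor_poly f m a).[x] =
  \sum_(k < m.+1) f k a / k`!%:R * (x - a) ^+ k.
Proof.
rewrite /taylor_poly horner_sum; apply: eq_bigr => k _.
by rewrite hornerZ horner_exp !hornerE.
Qed.

Lemma horner_deriv_taylor_poly f m a x : (deriv (taylor_poly f m a)).[x] =
  \sum_(k < m) f k.+1 a / k`!%:R * (x - a) ^+ k.
Proof.
rewrite /taylor_poly raddf_sum horner_sum big_ord_recl /= derivZ expr0 -polyC1 derivC.
rewrite scaler0 horner0 add0r; apply: eq_bigr => k _.
rewrite derivZ deriv_exp derivXsubC mul1r hornerZ hornerMn horner_exp !hornerE.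
rewrite /bump /= add1n factS natrM -[X in _ * X = _]mulr_natl mulrA; congr (_ * _).
have : k.+1%:R != 0 :> R by rewrite pnatr_eq0.
have : k`!%:R != 0 :> R by rewrite pnatr_eq0 -lt0n fact_gt0.
by move: (k.+1%:R) (k`!%:R) => p q q0 p0; field; rewrite p0 q0.
Qed.

Lemma horner_taylor_poly_center f m a : (taylor_poly f m a).[a] = f 0%N a.
Proof.
rewrite horner_taylor_poly big_ord_recl /= subrr expr0 mulr1 fact0 divr1.
by rewrite big1 ?addr0// => i _; rewrite expr0n /= mulr0.
Qed.

Section Remainder.
Variables (f : nat -> R -> R) (m : nat) (a b B : R).
Hypotheses (jf : jet f) (ab : a < b).
Hypothesis fB : forall x, a <= x <= b -> `|f m.+1 x| <= B.

Lemma taylor_poly_remainder x : a <= x <= b ->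
  `|f 0%N x - (taylor_poly f m a).[x]| <= B * (b - a) ^+ m.+1.
Proof.
move=> xab; rewrite horner_taylor_poly.
apply: le_trans (taylor_bound jf (M := B) _) _.
  by move=> z zx; apply: fB; case/orP: zx; lra.
have B0 : 0 <= B by apply: le_trans (fB xab).
rewrite ler_wpM2l// lerXn2r ?nnegrE//; first by rewrite subr_ge0 ltW.
by rewrite ger0_norm; lra.
Qed.

Lemma deriv_taylor_poly_remainder x : a <= x <= b ->
  `|f 1%N x - (deriv (taylor_poly f m a)).[x]| <= B * (b - a) ^+ m.
Proof.
move=> xab; rewrite horner_deriv_taylor_poly.
apply: le_trans (taylor_bound (jet_shift 1 jf) (M := B) _) _.
  by move=> z zx; apply: fB; case/orP: zx; lra.
have B0 : 0 <= B by apply: le_trans (fB xab).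
rewrite ler_wpM2l// lerXn2r ?nnegrE//; first by rewrite subr_ge0 ltW.
by rewrite ger0_norm; lra.
Qed.

End Remainder.

Lemma continuous_poly_speed (p q : {poly R}) :
  continuous (fun x => `|p.[x]| + `|q.[x]|).
Proof.
move=> x; have cn (r : {poly R}) : {for x, continuous (fun y => `|r.[y]|)}.
  by apply: continuous_comp; [exact: continuous_horner|exact: norm_continuous].
exact: continuousD (cn p) (cn q).
Qed.

(** Here P, Q are Taylor polynomials, p', q' their derivatives, p0, q0 their values at a, and r, s,
    r', s' the remainders of the functions and of their derivatives. The correction terms of the
    discrepancy replace P and Q by P - p0 and Q - q0 next to s' and r', and these differences are
    bounded by the integral I in the velocity. *)
Lemma area_integrand_bound (p' q' P Q p0 q0 r s r' s' d I b1 b2 : R) :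
  `|r| <= b1 -> `|s| <= b1 -> `|r'| <= b2 -> `|s'| <= b2 ->
  `|P - p0| <= I -> `|Q - q0| <= I ->
  d = - 2 * (p' * Q - q' * P) + 2 * p0 * s' - 2 * q0 * r' +
    2 * ((p' + r') * (Q + s) - (q' + s') * (P + r)) ->
  `|d| <= 2 * (b1 * (`|p'| + `|q'|)) + (4 * (b2 * I) + 4 * (b1 * b2)).
Proof.
move=> hr hs hr' hs' hP hQ ->.
rewrite [X in `|X|](_ : _ = 2 * (p' * s - q' * r + r' * (Q - q0) - s' * (P - p0)
   + (r' * s - r * s'))); last by ring.
rewrite normrM (ger0_norm (x := 2))//.
have M (x y u v : R) : `|x| <= u -> `|y| <= v -> `|x * y| <= u * v.
  by move=> xu yv; rewrite normrM ler_pM.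
have h1 := M _ _ _ _ (lexx `|p'|) hs.
have h2 := M _ _ _ _ (lexx `|q'|) hr.
have h3 := M _ _ _ _ hr' hQ.
have h4 := M _ _ _ _ hs' hP.
have h5 := M _ _ _ _ hr' hs.
have h6 := M _ _ _ _ hr hs'.
move: h1 h2 h3 h4 h5 h6; rewrite !ler_norml.
move=> /andP[? ?] /andP[? ?] /andP[? ?] /andP[? ?] /andP[? ?] /andP[? ?].
have : `|p' * s - q' * r + r' * (Q - q0) - s' * (P - p0) + (r' * s - r * s')|
    <= `|p'| * b1 + `|q'| * b1 + b2 * I + b2 * I + (b2 * b1 + b1 * b2).
  by rewrite ler_norml; apply/andP; split; lra.
by lra.
Qed.

(** The increment of h cancels, so h is arbitrary: for a horizontal curve the subtracted quantity is
    0, and in the converse it is the area deficit. *)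
Lemma area_estimate f g m c d : jet f -> jet g -> exists2 C : R, 0 < C &
  forall a b h X, c <= a -> a < b -> b <= d -> area_primitive f g X ->
    `|area_discrepancy f g h m a b - (h 0%N b - h 0%N a - 2 * (X b - X a))|
      <= C * velocity f g m a b.
Proof.
move=> jf jg.
have [Bf Bf0 fB] := jet_bounded m.+1 c d jf.
have [Bg Bg0 gB] := jet_bounded m.+1 c d jg.
pose B := Bf + Bg.
have B0 : 0 < B by rewrite addr_gt0.
exists (6 * B + 4 * (B * B)) => [|a b h X ca ab bd pX].
  by rewrite addr_gt0 ?mulr_gt0.
have fB' x : a <= x <= b -> `|f m.+1 x| <= B.
  by move=> xab; apply: le_trans (fB x _) _; rewrite /B; lra.
have gB' x : a <= x <= b -> `|g m.+1 x| <= B.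
  by move=> xab; apply: le_trans (gB x _) _; rewrite /B; lra.
rewrite /area_discrepancy /velocity.
set P := taylor_poly f m a; set Q := taylor_poly g m a.
have cv := @continuous_poly_speed (deriv P) (deriv Q).
have [v dv] := continuous_primitive cv.
rewrite (Rintegral_primitive ab cv dv).
have dP x := is_derive_poly P x; have dQ x := is_derive_poly Q x.
have [Y dY] : exists Y : R -> R, forall x,
    is_derive x (1 : R) Y ((deriv P * Q - deriv Q * P).[x]).
  by apply: continuous_primitive; exact: continuous_horner.
have -> : (\int[@lebesgue_measure R]_(x in `[a, b])
    ((deriv P).[x] * Q.[x] - (deriv Q).[x] * P.[x])) = Y b - Y a.
  rewrite -(Rintegral_primitive ab (@continuous_horner R _) dY).
  by apply: eq_Rintegral => x _; rewrite !hornerE.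
(* The integral in the velocity; it bounds the oscillation of both Taylor polynomials on [a, b]. *)
pose I := v b - v a.
pose l := b - a; have l0 : 0 < l by rewrite /l; lra.
have vmon x y : x <= y -> v x <= v y.
  move=> xy.
  have := ler_growth xy (fun x => is_derive_const x 0) dv _.
  rewrite subrr normr0 subr_ge0; by apply => z _; exact: addr_ge0.
have Pv x : a <= x <= b -> `|P.[x] - P.[a]| <= I.
  move=> xab; have ax : a <= x by lra.
  have xb : v x <= v b by apply: vmon; lra.
  have H z : a <= z <= x -> `|P^`().[z]| <= `|(deriv P).[z]| + `|(deriv Q).[z]|.
    by move=> _; rewrite lerDl.
  have := ler_growth ax dP dv H; rewrite /I; lra.
have Qv x : a <= x <= b -> `|Q.[x] - Q.[a]| <= I.
  move=> xab; have ax : a <= x by lra.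
  have xb : v x <= v b by apply: vmon; lra.
  have H z : a <= z <= x -> `|Q^`().[z]| <= `|(deriv P).[z]| + `|(deriv Q).[z]|.
    by move=> _; rewrite lerDr.
  have := ler_growth ax dQ dv H; rewrite /I; lra.
have Pa : P.[a] = f 0%N a by exact: horner_taylor_poly_center.
have Qa : Q.[a] = g 0%N a by exact: horner_taylor_poly_center.
(* The quantity to bound, as a function of the right endpoint x and up to a constant. *)
pose D x := - 2 * Y x + 2 * f 0%N a * (g 0%N x - Q.[x])
  - 2 * g 0%N a * (f 0%N x - P.[x]) + 2 * X x.
pose D' x := - 2 * (deriv P * Q - deriv Q * P).[x]
  + 2 * f 0%N a * (g 1%N x - (deriv Q).[x])
  - 2 * g 0%N a * (f 1%N x - (deriv P).[x])
  + 2 * (f 1%N x * g 0%N x - g 1%N x * f 0%N x).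
have dD x : is_derive x (1 : R) D (D' x).
  have d1 := is_derive_scale (- 2) (dY x).
  have d2 := is_derive_scale (2 * f 0%N a) (is_derive_sub (jg 0%N x) (dQ x)).
  have d3 := is_derive_scale (2 * g 0%N a) (is_derive_sub (jf 0%N x) (dP x)).
  have d4 := is_derive_scale 2 (pX x).
  exact: is_derive_add (is_derive_sub (is_derive_add d1 d2) d3) d4.
pose b1 := B * l ^+ m.+1; pose b2 := B * l ^+ m.
pose k := 4 * (b2 * I) + 4 * (b1 * b2).
pose W x := 2 * (b1 * v x) + k * x.
have dW x : is_derive x (1 : R) W
    (2 * (b1 * (`|(deriv P).[x]| + `|(deriv Q).[x]|)) + k * 1).
  have d1 := is_derive_scale k (is_derive_id x 1).
  exact: is_derive_add (is_derive_scale 2 (is_derive_scale b1 (dv x))) d1.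
have := ler_growth (ltW ab) dD dW _.
have -> : D b - D a = h 0%N b - h 0%N a - 2 * (Y b - Y a)
    + 2 * f 0%N a * (g 0%N b - Q.[b]) - 2 * g 0%N a * (f 0%N b - P.[b])
    - (h 0%N b - h 0%N a - 2 * (X b - X a)).
  by rewrite /D Pa Qa; ring.
move=> /(_ _)/le_trans; apply.
  move=> x xab; rewrite mulr1.
  apply: (area_integrand_bound (r := f 0%N x - P.[x]) (s := g 0%N x - Q.[x])
    (r' := f 1%N x - (deriv P).[x]) (s' := g 1%N x - (deriv Q).[x])
    (P := P.[x]) (Q := Q.[x]) (p0 := P.[a]) (q0 := Q.[a])).
  - exact: taylor_poly_remainder fB' _ xab.
  - exact: taylor_poly_remainder gB' _ xab.
  - exact: deriv_taylor_poly_remainder fB' _ xab.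
  - exact: deriv_taylor_poly_remainder gB' _ xab.
  - exact: Pv.
  - exact: Qv.
  - by rewrite /D' Pa Qa hornerD hornerN !hornerM; ring.
have I0 : 0 <= I by rewrite subr_ge0; apply: vmon; exact: ltW.
have -> : W b - W a = 6 * B * (l ^+ m.+1 * I) + 4 * (B * B) * l ^+ (2 * m + 2).
  rewrite /W /k /b1 /b2 /I /l exprS (_ : (2 * m + 2 = m + m + 2)%N); last lia.
  by rewrite !exprD; ring.
have l1 : 0 <= l ^+ m.+1 * I by rewrite mulr_ge0// exprn_ge0// ltW.
have l2 : 0 <= l ^+ (2 * m + 2) by rewrite exprn_ge0// ltW.
rewrite -/l -/I.
have := mulr_ge0 (ltW B0) l2; have := mulr_ge0 (ltW (mulr_gt0 B0 B0)) l1.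
by lra.
Qed.

(** The speeds of a curve and of its Taylor polynomial differ by at most B l^m in each coordinate. A
    constant s gives velocity O(l^(m+1)) on short gaps; s = l^m gives O(l^(2m+2)). *)
Lemma velocity_le f g m a b (B s : R) : jet f -> jet g -> a < b ->
  (forall x, a <= x <= b -> `|f m.+1 x| <= B) ->
  (forall x, a <= x <= b -> `|g m.+1 x| <= B) ->
  (forall x, a <= x <= b -> `|f 1%N x| <= s) ->
  (forall x, a <= x <= b -> `|g 1%N x| <= s) ->
  velocity f g m a b <= (b - a) ^+ (2 * m + 2) +
    (b - a) ^+ m.+1 * (2 * (s + B * (b - a) ^+ m) * (b - a)).
Proof.
move=> jf jg ab fB gB fs gs; rewrite /velocity lerD2l ler_wpM2l//.
  by rewrite exprn_ge0// subr_ge0 ltW.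
set P := taylor_poly f m a; set Q := taylor_poly g m a.
have cv := @continuous_poly_speed (deriv P) (deriv Q).
have [v dv] := continuous_primitive cv.
rewrite (Rintegral_primitive ab cv dv).
pose k := 2 * (s + B * (b - a) ^+ m).
have dk x : is_derive x (1 : R) (fun y => k * y) (k * 1).
  exact: is_derive_scale (is_derive_id _ _).
rewrite mulrBr; apply: le_trans (ler_norm _) (ler_growth (ltW ab) dv dk _) => x xab.
rewrite mulr1 ger0_norm ?addr_ge0//.
have near_le (y z e : R) : `|y| <= s -> `|y - z| <= e -> `|z| <= s + e.
  move=> ys yz; rewrite (_ : z = y - (y - z)); last ring.
  by rewrite (le_trans (ler_normB _ _))// lerD.
have := near_le _ _ _ (fs _ xab) (deriv_taylor_poly_remainder jf ab fB xab).
have := near_le _ _ _ (gs _ xab) (deriv_taylor_poly_remainder jg ab gB xab).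
by rewrite /k; lra.
Qed.

End Area.

(** * Correcting the area of one gap *)

Section Perturbation.
Variable R : realType.
Implicit Types (f g w : nat -> R -> R) (X : R -> R) (a b x : R) (m p k : nat).

Definition flat_at w a := forall k, w k a = 0.

Definition rescale w (x1 r : R) : nat -> R -> R :=
  fun k x => r^-1 ^+ k * w k (r^-1 * x + - (x1 / r)).

Lemma rescale_jet w x1 r : jet w -> jet (rescale w x1 r).
Proof. exact: jet_affine. Qed.

(** Integration by parts: the change of the integrand differs from N' by the derivative of phi g - f
    psi, which vanishes at both ends. The linear part of N' then involves f' and g' instead of f and
    g. *)
Lemma perturbed_area f g (phi psi : nat -> R -> R) X Y N a b :
  jet f -> jet g -> jet phi -> jet psi ->
  flat_at phi a -> flat_at phi b -> flat_at psi a -> flat_at psi b ->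
  area_primitive f g X ->
  area_primitive (fun k x => f k x + phi k x) (fun k x => g k x + psi k x) Y ->
  (forall x, is_derive x (1 : R) N (2 * (f 1%N x * psi 0%N x - phi 0%N x * g 1%N x)
     + (phi 1%N x * psi 0%N x - phi 0%N x * psi 1%N x))) ->
  Y b - Y a = X b - X a + (N b - N a).
Proof.
move=> jf jg jp jq pa pb qa qb pX pY dN.
pose D x := Y x - X x - N x - (phi 0%N x * g 0%N x - f 0%N x * psi 0%N x).
have dD x : is_derive x (1 : R) D 0.
  have d1 := is_derive_mul (jp 0%N x) (jg 0%N x).
  have d2 := is_derive_mul (jf 0%N x) (jq 0%N x).
  have := is_derive_sub (is_derive_sub (is_derive_sub (pY x) (pX x)) (dN x))
    (is_derive_sub d1 d2).
  by move=> /is_derive_eq; apply; ring.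
have := is_derive_0_is_cst b a dD; rewrite /D pa pb qa qb; lra.
Qed.

Lemma expr_inv_le (l : R) i j : 0 < l -> l <= 1 -> (j + 2 <= i)%N ->
  l ^+ i * l^-1 ^+ j <= l ^+ 2.
Proof.
move=> l0 l1 ij; have -> : (i = (i - j) + j)%N by lia.
rewrite exprD -mulrA exprVn mulfV ?mulr1 ?expf_neq0 ?gt_eqF//.
by apply: ler_wiXn2l; [exact: ltW|exact: l1|lia].
Qed.

Section Bumps.
Variables (th : nat -> R -> R) (Bt : nat -> R).
Hypotheses (jt : jet th) (t0 : forall k x, x <= 0 -> th k x = 0)
  (t1 : forall k x, 1 <= x -> th k x = (k == 0%N)%:R)
  (tp : forall x, 0 <= th 1%N x)
  (Bt0 : forall k, 0 < Bt k) (tB : forall k x, `|th k x| <= Bt k).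

(** Nonnegative, supported in [0, 1] and of integral 1, since [th] climbs there from 0 to 1. *)
Let bump k := th k.+1.

(** With phi = 0 the change of area is exactly linear in psi: N = 2 n, so twice its increment is 4
    (n b - n a). A bump of width r placed where f' keeps its sign and is at least s in absolute
    value contributes at least s r, and scaling it reaches T. *)
Lemma bump_linear f a b x0 (r s T : R) : jet f -> a <= x0 <= b ->
  0 < r -> 2 * r <= b - a -> 0 < s -> 2 * s <= `|f 1%N x0| ->
  (forall x, `|x - x0| <= r -> `|f 1%N x - f 1%N x0| <= s) ->
  exists psi : nat -> R -> R, exists n : R -> R,
    [/\ jet psi, flat_at psi a, flat_at psi b,
      forall k x, `|psi k x| <= `|T| / (4 * s * r) * (r^-1 ^+ k * Bt k.+1) &
      (forall x, is_derive x (1 : R) n (f 1%N x * psi 0%N x)) /\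
      4 * (n b - n a) = T].
Proof.
move=> jf x0ab r0 rab s0 fx0 near_x0.
(* The support [x1, x1 + r] must stay in [a, b] and within r of x0: put it right of x0 if there is
   room, else left. *)
have [x1 [ax1 x1b x1x0]] : exists x1, [/\ a <= x1, x1 + r <= b & x1 <= x0 <= x1 + r].
  have [x0r|x0r] := leP (x0 + r) b; first by exists x0; split; lra.
  by exists (x0 - r); split; lra.
have jb : jet bump by exact: (jet_shift 1 jt).
pose be := rescale bump x1 r.
have jbe : jet be by exact: rescale_jet.
have argE x : r^-1 * x + - (x1 / r) = (x - x1) / r by ring.
have arg_le0 x : x <= x1 -> r^-1 * x + - (x1 / r) <= 0.
  by move=> xx; rewrite argE ler_pdivrMr//; lra.
have arg_ge1 x : x1 + r <= x -> 1 <= r^-1 * x + - (x1 / r).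
  by move=> xx; rewrite argE ler_pdivlMr//; lra.
have be_l k x : x <= x1 -> be k x = 0.
  by move=> xx; rewrite /be /rescale /bump t0 ?mulr0// arg_le0.
have be_r k x : x1 + r <= x -> be k x = 0.
  by move=> xx; rewrite /be /rescale /bump t1 ?mulr0// arg_ge1.
have bep x : 0 <= be 0%N x by rewrite /be /rescale expr0 mul1r tp.
have [n dn] := @continuous_primitive R (fun x => f 1%N x * be 0%N x)
  (fun x => is_derive_continuous (is_derive_mul (jf 1%N x) (jbe 0%N x))).
have big : s * r <= `|n b - n a|.
  pose v x := s * r * th 0%N (r^-1 * x + - (x1 / r)).
  have dv x : is_derive x (1 : R) v (s * be 0%N x).
    have := is_derive_scale (s * r)
      (@is_derive_affine R (th 0%N) x r^-1 (- (x1 / r)) _ (jt 0%N _)).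
    move=> /is_derive_eq; apply; rewrite /be /rescale /bump expr0.
    by rewrite mulrA mulfK ?gt_eqF// mul1r.
  have vab : v b - v a = s * r.
    by rewrite /v t1 ?arg_ge1//= t0 ?arg_le0//; ring.
  have ab : a <= b by lra.
  have pw x : x1 <= x <= x1 + r -> `|f 1%N x - f 1%N x0| <= s.
    by move=> xx; apply: near_x0; rewrite ler_norml; lra.
  have [fp|fn] := leP 0 (f 1%N x0).
    rewrite ger0_norm// in fx0.
    have H x : a <= x <= b -> `|s * be 0%N x| <= f 1%N x * be 0%N x.
      move=> _; rewrite (ger0_norm (mulr_ge0 (ltW s0) (bep x))).
      have [xl|xl] := leP x x1; first by rewrite be_l// !mulr0.
      have [xr|xr] := leP (x1 + r) x; first by rewrite be_r// !mulr0.
      rewrite ler_wpM2r//; have := pw x; rewrite ler_norml; lra.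
    have := ler_growth ab dv dn H; rewrite vab => /(le_trans (ler_norm _)) h.
    exact: le_trans h (ler_norm _).
  rewrite ltr0_norm// in fx0.
  have dn' x : is_derive x (1 : R) (fun x => -1 * n x) (-1 * (f 1%N x * be 0%N x)).
    exact: is_derive_scale.
  have H x : a <= x <= b -> `|s * be 0%N x| <= -1 * (f 1%N x * be 0%N x).
    move=> _; rewrite (ger0_norm (mulr_ge0 (ltW s0) (bep x))).
    have [xl|xl] := leP x x1; first by rewrite be_l// !mulr0.
    have [xr|xr] := leP (x1 + r) x; first by rewrite be_r// !mulr0.
    rewrite (mulrA (-1)) ler_wpM2r//; have := pw x; rewrite ler_norml; lra.
  have := ler_growth ab dv dn' H; rewrite vab => /(le_trans (ler_norm _)) h.
  rewrite -normrN; apply: le_trans (ler_norm _); lra.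
have sr : 0 < s * r by rewrite mulr_gt0.
have n0 : n b - n a != 0 by rewrite -normr_gt0; apply: lt_le_trans big.
pose la := T / (4 * (n b - n a)).
exists (fun k x => la * be k x), (fun x => la * n x); split.
- exact: jet_scale.
- by move=> k; rewrite be_l ?mulr0.
- by move=> k; rewrite be_r ?mulr0.
- move=> k x; rewrite normrM; apply: ler_pM => //.
    rewrite normrM ler_wpM2l// normfV lef_pV2 ?posrE ?normr_gt0 ?mulf_neq0//.
    - by rewrite normrM ger0_norm// -mulrA ler_wpM2l.
    - by rewrite -mulrA mulr_gt0.
  rewrite normrM ger0_norm ?exprn_ge0 ?invr_ge0 ?(ltW r0)// ler_wpM2l//.
    by rewrite exprn_ge0 ?invr_ge0 ?(ltW r0).
  exact: tB.
- split=> [x|].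
    by apply: is_derive_eq (is_derive_scale la (dn x)) _; ring.
  by rewrite /la; field.
Qed.

(** The size of the root is read off the equation: if [|s| > 4 D], then q s^2 exceeds 3 D [|s|],
    which outweighs both e s and t. *)
Lemma quadratic_root (q e t D : R) : 3 / 4 <= q -> 0 <= t -> `|e| <= D ->
  t <= D ^+ 2 -> exists2 s : R, q * s ^+ 2 + e * s = t & `|s| <= 4 * D.
Proof.
move=> q34 tge0 eD tD.
have q0 : 0 < q by lra.
have disc : 0 <= e ^+ 2 + 4 * q * t by rewrite addr_ge0 ?sqr_ge0// !mulr_ge0//; lra.
pose z := Num.sqrt (e ^+ 2 + 4 * q * t).
have zz : z ^+ 2 = e ^+ 2 + 4 * q * t by rewrite sqr_sqrtr.
have E : q * ((z - e) / (2 * q)) ^+ 2 + e * ((z - e) / (2 * q)) = t.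
  have -> : t = (z ^+ 2 - e ^+ 2) / (4 * q) by rewrite zz; field; lra.
  by field; lra.
exists ((z - e) / (2 * q)) => //.
move: E; move: (_ / _) => s E.
have D0 : 0 <= D by apply: le_trans eD.
rewrite leNgt; apply/negP => sD.
have : t < q * s ^+ 2 + e * s; last by rewrite E ltxx.
have s2 : s ^+ 2 = `|s| ^+ 2 by rewrite real_normK ?num_real.
have es : - (D * `|s|) <= e * s.
  have : `|e * s| <= D * `|s| by rewrite normrM ler_wpM2r.
  by rewrite ler_norml => /andP[].
rewrite s2; have s0 : 0 < `|s| by apply: le_lt_trans sD; lra.
have h1 : 4 * D * `|s| <= `|s| ^+ 2 by rewrite expr2 ler_wpM2r// ltW.
have h2 : D * D <= D * `|s| by rewrite ler_wpM2l//; lra.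
have h3 : 3 / 4 * `|s| ^+ 2 <= q * `|s| ^+ 2 by rewrite ler_wpM2r// exprn_ge0.
have h4 : 0 < `|s| ^+ 2 by rewrite exprn_gt0.
move: tD; rewrite (expr2 D) => tD.
lra.
Qed.

(** The jet of x beta(x), where beta is the bump. The pair phi = beta, psi = x beta gives phi' psi -
    phi psi' = - beta^2, so this loop encloses a nonzero area. *)
Let tilt k x : R := x * bump k x + k%:R * bump k.-1 x.

Lemma tilt_jet : jet tilt.
Proof.
move=> k x; have jb : jet bump by exact: (jet_shift 1 jt).
have d1 := is_derive_mul (is_derive_id x (1 : R)) (jb k x).
case: k d1 => [|k] d1.
  by apply: is_derive_ext (is_derive_eq d1 _) => [y|]; rewrite /tilt /=; ring.
apply: is_derive_eq (is_derive_add d1 (is_derive_scale k.+1%:R (jb k x))) _.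
by rewrite /tilt -[k.+2%:R]natr1 /=; ring.
Qed.

Lemma tilt0 k : tilt k 0 = 0.
Proof. by rewrite /tilt /bump !t0// !mulr0 addr0. Qed.

Lemma tilt1 k : tilt k 1 = 0.
Proof. by rewrite /tilt /bump !t1// !mulr0 addr0. Qed.

(** The loop s (beta, tau x beta), rescaled to [a, b], changes the area by a term in s^2 that is
    independent of b - a and a linear term from f' and g'; s solves the resulting quadratic
    equation. *)
Lemma bump_quadratic f g a b (s0 D T : R) : jet f -> jet g -> a < b ->
  (forall x, a <= x <= b -> `|f 1%N x| <= s0) ->
  (forall x, a <= x <= b -> `|g 1%N x| <= s0) ->
  4 * s0 * Bt 1%N * (b - a) <= D -> `|T| / 2 <= D ^+ 2 ->
  exists phi psi : nat -> R -> R, exists N : R -> R,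
    [/\ jet phi /\ jet psi,
      [/\ flat_at phi a, flat_at phi b, flat_at psi a & flat_at psi b],
      forall k x, a <= x <= b ->
        `|phi k x| <= 4 * D * ((b - a)^-1 ^+ k * (Bt k.+1 + k%:R * Bt k)) /\
        `|psi k x| <= 4 * D * ((b - a)^-1 ^+ k * (Bt k.+1 + k%:R * Bt k)),
      (forall x, is_derive x (1 : R) N
        (2 * (f 1%N x * psi 0%N x - phi 0%N x * g 1%N x)
          + (phi 1%N x * psi 0%N x - phi 0%N x * psi 1%N x))) &
      2 * (N b - N a) = T].
Proof.
move=> jf jg ab fs gs Ds TD.
pose l := b - a; have l0 : 0 < l by rewrite /l; lra.
have jb : jet bump by exact: (jet_shift 1 jt).
have jw := tilt_jet.
pose be := rescale bump a l; pose ti := rescale tilt a l.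
have jbe : jet be by exact: rescale_jet.
have jti : jet ti by exact: rescale_jet.
have argE x : l^-1 * x + - (a / l) = (x - a) / l by ring.
have arga : l^-1 * a + - (a / l) = 0 by rewrite argE subrr mul0r.
have argb : l^-1 * b + - (a / l) = 1 by rewrite argE divff// gt_eqF.
have arg01 x : a <= x <= b -> 0 <= l^-1 * x + - (a / l) <= 1.
  move=> xab; have xa : 0 <= x - a by lra.
  by rewrite argE (divr_ge0 xa (ltW l0)) /= ler_pdivrMr// mul1r /l; lra.
have lk k : 0 <= l^-1 ^+ k by rewrite exprn_ge0// invr_ge0 ltW.
have be_bd k x : `|be k x| <= l^-1 ^+ k * (Bt k.+1 + k%:R * Bt k).
  rewrite normrM (ger0_norm (lk k)) ler_wpM2l// (le_trans (tB _ _))// lerDl.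
  by rewrite mulr_ge0// ltW.
have ti_bd k x : a <= x <= b -> `|ti k x| <= l^-1 ^+ k * (Bt k.+1 + k%:R * Bt k).
  move=> /arg01/andP[z0 z1]; rewrite normrM (ger0_norm (lk k)) ler_wpM2l//.
  rewrite /tilt; move: z0 z1; move: (_ + _) => z z0 z1.
  have h1 : `|z * bump k z| <= Bt k.+1.
    rewrite normrM (ger0_norm z0); apply: le_trans (tB k.+1 z).
    by rewrite ler_piMl.
  have h2 : `|k%:R * bump k.-1 z| <= k%:R * Bt k.
    case: {h1} k => [|k]; first by rewrite !mul0r normr0.
    by rewrite normrM ger0_norm// ler_wpM2l//; exact: tB.
  exact: le_trans (ler_normD _ _) (lerD h1 h2).
have be0_bd x : `|be 0%N x| <= Bt 1%N.
  by apply: le_trans (be_bd 0%N x) _; rewrite expr0 mul1r mul0r addr0.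
have ti0_bd x : a <= x <= b -> `|ti 0%N x| <= Bt 1%N.
  by move=> /(ti_bd 0%N)/le_trans; apply; rewrite expr0 mul1r mul0r addr0.
have [Q dQ] : exists Q : R -> R, forall y, is_derive y (1 : R) Q (bump 0%N y * bump 0%N y).
  apply: continuous_primitive => y.
  exact: is_derive_continuous (is_derive_mul (jb 0%N y) (jb 0%N y)).
(* Integrate beta <= beta^2 + 1/4 over [0, 1], where beta has integral 1. *)
have q34 : 3 / 4 <= Q 1 - Q 0.
  have dQ' y : is_derive y (1 : R) (fun y => Q y + 4^-1 * y)
      (bump 0%N y * bump 0%N y + 4^-1 * 1).
    exact: is_derive_add (dQ y) (is_derive_scale _ (is_derive_id _ _)).
  have H y : 0 <= y <= 1 -> `|bump 0%N y| <= bump 0%N y * bump 0%N y + 4^-1 * 1.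
    move=> _; rewrite ger0_norm; last exact: tp.
    by have := sqr_ge0 (bump 0%N y - 2^-1); rewrite expr2; lra.
  have := ler_growth ler01 (jt 0%N) dQ' H.
  by rewrite t1// t0// subr0 /= normr1; lra.
(* The orientation of the loop, chosen so that the equation for s has right side [|T| / 2 >= 0] and
   hence a real root. *)
pose tau : R := if 0 <= T then -1 else 1.
have tauT : - tau * `|T| = T.
  rewrite /tau; case: leP => T0; last by rewrite ltr0_norm//; ring.
  by rewrite ger0_norm//; ring.
have tau2 : tau * tau = 1 by rewrite /tau; case: ifP => _; ring.
have ntau : `|tau| = 1 by rewrite /tau; case: ifP => _; [exact: normrN1 | exact: normr1].
have dE x := is_derive_sub (is_derive_scale tau (is_derive_mul (jf 1%N x) (jti 0%N x)))
  (is_derive_mul (jbe 0%N x) (jg 1%N x)).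
have [d dd] : exists d : R -> R, forall x, is_derive x (1 : R) d
    (tau * (f 1%N x * ti 0%N x) - be 0%N x * g 1%N x).
  by apply: continuous_primitive => x; exact: is_derive_continuous (dE x).
have aab : a <= a <= b by rewrite lexx ltW.
have s00 : 0 <= s0 by apply: le_trans (fs a aab).
have d_bd : `|d b - d a| <= 2 * s0 * Bt 1%N * l.
  rewrite -(gtr0_norm l0); apply: (ler_mvt dd) => x xab.
  have {}xab : a <= x <= b by case/orP: xab; lra.
  rewrite (le_trans (ler_normB _ _))// normrM ntau mul1r.
  have h1 : `|f 1%N x * ti 0%N x| <= s0 * Bt 1%N.
    by rewrite normrM ler_pM ?fs ?ti0_bd.
  have h2 : `|be 0%N x * g 1%N x| <= Bt 1%N * s0.
    by rewrite normrM ler_pM ?gs.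
  by lra.
have [||s sE sD] := @quadratic_root (Q 1 - Q 0) (- tau * (2 * (d b - d a))) (`|T| / 2) D
    q34 _ _ TD.
- by rewrite divr_ge0.
- rewrite normrM normrN ntau mul1r normrM (ger0_norm (x := 2))//.
  by move: Ds d_bd; rewrite -/l; lra.
exists (fun k x => s * be k x), (fun k x => s * tau * ti k x).
exists (fun x => 2 * s * d x - s ^+ 2 * tau * Q (l^-1 * x + - (a / l))); split.
- by split; exact: jet_scale.
- split=> k; rewrite /be /ti /rescale ?arga ?argb ?tilt0 ?tilt1 ?mulr0//.
    by rewrite /bump t0// !mulr0.
  by rewrite /bump t1// !mulr0.
- move=> k x xab; split; first by rewrite normrM ler_pM.
  by rewrite -mulrA normrM normrM ntau mul1r ler_pM ?ti_bd.
- move=> x.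
  have dQl := @is_derive_affine R Q x l^-1 (- (a / l)) _ (dQ _).
  have := is_derive_sub (is_derive_scale (2 * s) (dd x))
    (is_derive_scale (s ^+ 2 * tau) dQl).
  move=> /is_derive_eq; apply; rewrite /be /ti /rescale /tilt /= !expr0 !expr1.
  by ring.
- rewrite arga argb; move: sE tauT.
  set q := Q 1 - Q 0; set dl := d b - d a => sE tauT.
  have -> : Q 1 = Q 0 + q by rewrite /q; ring.
  have -> : d b = d a + dl by rewrite /dl; ring.
  rewrite [LHS](_ : _ = 2 * - tau * (q * s ^+ 2 + - tau * (2 * dl) * s)
    + 4 * s * dl * (1 - tau * tau)); last by ring.
  by rewrite sE tau2; lra.
Qed.

Definition bump_bound p := 1 + \sum_(k < p) (Bt k.+1 + k%:R * Bt k).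

Lemma bump_bound_term_ge0 k : 0 <= Bt k.+1 + k%:R * Bt k.
Proof. by rewrite addr_ge0 ?mulr_ge0// ltW. Qed.

Lemma bump_bound_gt0 p : 0 < bump_bound p.
Proof. by rewrite ltr_wpDr// sumr_ge0// => i _; exact: bump_bound_term_ge0. Qed.

Lemma bump_bound_ge p k : (k < p)%N -> Bt k.+1 + k%:R * Bt k <= bump_bound p.
Proof.
move=> kp; rewrite /bump_bound (bigD1 (Ordinal kp))//= addrCA lerDl.
by rewrite addr_ge0// sumr_ge0// => i _; exact: bump_bound_term_ge0.
Qed.

(** [bump_linear] with width l^(q+2) and slope s = l^q / 2. In the exponent assumed for T, 2q + 2
    pays for the division by 4 s r, (q + 2) p for fewer than p derivatives at scale l^(q+2), and of
    the remaining l^2 one factor l absorbs the constants. *)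
Lemma linear_correction u a b x0 p q (B C T : R) : jet u -> a < b ->
  b - a <= 1 / 2 -> 0 <= B -> B * (b - a) <= 1 / 2 ->
  0 <= C -> C * bump_bound p * (b - a) <= 1 ->
  (forall x, a - 1 <= x <= b + 1 -> `|u 2%N x| <= B) ->
  a <= x0 <= b -> (b - a) ^+ q < `|u 1%N x0| ->
  `|T| <= C * (b - a) ^+ ((q + 2) * p + 2 + (2 * q + 2)) ->
  exists psi : nat -> R -> R, exists n : R -> R,
    [/\ jet psi, flat_at psi a, flat_at psi b,
      forall k x, (k < p)%N -> `|psi k x| <= b - a &
      (forall x, is_derive x (1 : R) n (u 1%N x * psi 0%N x)) /\
      4 * (n b - n a) = T].
Proof.
move=> ju ab; have : 0 < b - a by rewrite subr_gt0.
set l := b - a => l0 l2 B0 lB C0 lC uB x0ab ux0 Tl.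
have l1 : l <= 1 by apply: le_trans l2 _; lra.
have lX i : 0 < l ^+ i by rewrite exprn_gt0.
have r1 : l ^+ (q + 2) <= l ^+ 2.
  by apply: ler_wiXn2l; [exact: ltW|exact: l1|exact: leq_addl].
have r2 : l ^+ 2 <= l / 2.
  by rewrite expr2 ler_wpM2l ?(ltW l0)// -div1r.
(* The ball around x0 may leave [a, b], which is why u'' is bounded on [a - 1, b + 1]. *)
have near_x0 x : `|x - x0| <= l ^+ (q + 2) -> `|u 1%N x - u 1%N x0| <= l ^+ q / 2.
  move=> xx; have H z : (x0 <= z <= x) || (x <= z <= x0) -> `|u 2%N z| <= B.
    have : `|x - x0| <= 1 / 2 by apply: le_trans (le_trans xx (le_trans r1 r2)) _; lra.
    by rewrite ler_norml => {}xx zx; apply: uB; case/orP: zx; lra.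
  apply: le_trans (ler_mvt (ju 1%N) H) _.
  apply: (@le_trans _ _ (B * l ^+ (q + 2))); first by rewrite ler_wpM2l.
  rewrite exprD mulrCA ler_wpM2l ?(ltW (lX _))// expr2 mulrA.
  have := ler_pM (mulr_ge0 B0 (ltW l0)) (ltW l0) lB l1.
  by rewrite mulr1 div1r.
have [|||psi [n [jp pa pb pB pn]]] := @bump_linear u a b x0 (l ^+ (q + 2))
  (l ^+ q / 2) T ju x0ab (lX _) _ _ _ near_x0.
- by apply: le_trans (ler_wpM2l _ (le_trans r1 r2)) _ => //; rewrite mulrC divfK.
- by rewrite divr_gt0.
- by rewrite mulrC divfK// ltW.
exists psi, n; split=> // k x kp; apply: le_trans (pB k x) _.
have -> : 4 * (l ^+ q / 2) * l ^+ (q + 2) = 2 * l ^+ (2 * q + 2).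
  rewrite (_ : 2 * q + 2 = q + (q + 2))%N; last by rewrite mul2n -addnn addnA.
  by rewrite (exprD l q (q + 2)); field.
have T2 : `|T| / (2 * l ^+ (2 * q + 2)) <= C * l ^+ ((q + 2) * p + 2).
  rewrite ler_pdivrMr ?mulr_gt0//; apply: le_trans Tl _.
  rewrite exprD mulrA mulrCA -[leLHS]mul1r ler_wpM2r ?ler1n//.
  by rewrite mulr_ge0 ?mulr_ge0 ?(ltW (lX _)).
have r0 : 0 <= (l ^+ (q + 2))^-1 ^+ k by rewrite exprn_ge0// invr_ge0 ltW.
have T0 : 0 <= `|T| / (2 * l ^+ (2 * q + 2)).
  by rewrite divr_ge0// mulr_ge0// (ltW (lX _)).
have b0 : 0 <= (l ^+ (q + 2))^-1 ^+ k * Bt k.+1 by rewrite mulr_ge0// ltW.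
have bB : (l ^+ (q + 2))^-1 ^+ k * Bt k.+1 <= (l ^+ (q + 2))^-1 ^+ k * bump_bound p.
  rewrite ler_wpM2l//; apply: le_trans (bump_bound_ge kp).
  by rewrite lerDl mulr_ge0// ltW.
apply: le_trans (ler_pM T0 b0 T2 bB) _.
rewrite -exprVn -exprM.
have kpq : ((q + 2) * k + 2 <= (q + 2) * p + 2)%N.
  by rewrite leq_add2r leq_mul2l (ltnW kp) orbT.
have e := expr_inv_le l0 l1 kpq.
rewrite mulrA -(mulrA C) -mulrA [X in _ * X]mulrC mulrA.
apply: (@le_trans _ _ (C * bump_bound p * l ^+ 2)).
  by rewrite ler_wpM2l// mulr_ge0// ltW// bump_bound_gt0.
by rewrite expr2 mulrA ler_piMl// ltW.
Qed.

(** Use D = K l^(p+2). The summand [4 * Bt 1] covers the linear coefficient, C covers T, and K >= 1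
    allows K <= K^2; fewer than p derivatives at scale l still leave l^2. *)
Lemma quadratic_correction f g a b p (C T : R) (K := 1 + C + 4 * Bt 1%N) :
  jet f -> jet g -> a < b -> b - a <= 1 -> 0 <= C ->
  4 * (K * bump_bound p * (b - a)) <= 1 ->
  (forall x, a <= x <= b -> `|f 1%N x| <= (b - a) ^+ p.+1) ->
  (forall x, a <= x <= b -> `|g 1%N x| <= (b - a) ^+ p.+1) ->
  `|T| <= C * (b - a) ^+ (2 * p.+1 + 2) ->
  exists phi psi : nat -> R -> R, exists N : R -> R,
    [/\ jet phi /\ jet psi,
      [/\ flat_at phi a, flat_at phi b, flat_at psi a & flat_at psi b],
      forall k x, (k < p)%N -> a <= x <= b ->
        `|phi k x| <= b - a /\ `|psi k x| <= b - a,
      (forall x, is_derive x (1 : R) N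
        (2 * (f 1%N x * psi 0%N x - phi 0%N x * g 1%N x)
          + (phi 1%N x * psi 0%N x - phi 0%N x * psi 1%N x))) &
      2 * (N b - N a) = T].
Proof.
move=> jf jg ab; have : 0 < b - a by rewrite subr_gt0.
set l := b - a => l0 l1 C0 lK hf hg Tl.
have lX i : 0 < l ^+ i by rewrite exprn_gt0.
have BT0 := Bt0 1.
have K1 : 1 <= K by rewrite /K; lra.
pose D := K * l ^+ p.+2.
have D1 : 4 * l ^+ p.+1 * Bt 1%N * (b - a) <= D.
  rewrite /D -/l [l ^+ p.+2]exprSr mulrA ler_wpM2r ?(ltW l0)//.
  rewrite mulrAC ler_wpM2r ?(ltW (lX _))//.
  by rewrite /K; lra.
have D2 : `|T| / 2 <= D ^+ 2.
  rewrite /D exprMn -exprM (_ : p.+2 * 2 = 2 * p.+1 + 2)%N; last by rewrite mulnC mulnS addnC.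
  apply: (@le_trans _ _ `|T|); first by rewrite ler_piMr// invf_le1// ler1n.
  apply: le_trans Tl _; rewrite ler_wpM2r ?(ltW (lX _))//.
  apply: (@le_trans _ _ K); first by rewrite /K; lra.
  by rewrite expr2 ler_peMl// (le_trans ler01 K1).
have [phi [psi [N [jpq fpq B dN E]]]] := bump_quadratic jf jg ab hf hg D1 D2.
exists phi, psi, N; split=> // k x kp xab.
suff H : 4 * D * ((b - a)^-1 ^+ k * (Bt k.+1 + k%:R * Bt k)) <= b - a.
  by have [h1 h2] := B k x xab; split; [exact: le_trans H|exact: le_trans H].
have kq : (k + 2 <= p.+2)%N by rewrite addn2 !ltnS ltnW.
have e := expr_inv_le l0 l1 kq.
have e0 : 0 <= l ^+ p.+2 * l^-1 ^+ k.
  by rewrite mulr_ge0 ?(ltW (lX _))// exprn_ge0// invr_ge0 ltW.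
have h := ler_pM e0 (bump_bound_term_ge0 k) e (bump_bound_ge kp).
have K0 : 0 <= 4 * K by rewrite mulr_ge0// (le_trans ler01 K1).
rewrite -/l [leLHS](_ : _ = 4 * K * (l ^+ p.+2 * l^-1 ^+ k * (Bt k.+1 + k%:R * Bt k)));
  last by rewrite /D; ring.
apply: le_trans (ler_wpM2l K0 h) _.
rewrite [leLHS](_ : _ = 4 * (K * bump_bound p * l) * l); last by ring.
by rewrite ler_piMl// ltW.
Qed.

End Bumps.
End Perturbation.

(** * Corrections that are small up to a given order *)

Section Correction.
Variable R : realType.
Implicit Types (f g u : nat -> R -> R) (X : R -> R) (a b c d x T : R) (m p k : nat).

(** T is the change required of twice the area. Quantifying over Y absorbs the choice of a
    primitive. At p = 0 no size is imposed. *)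
Definition corrects f g X p a b T := exists phi psi : nat -> R -> R,
  [/\ jet phi /\ jet psi,
    [/\ flat_at phi a, flat_at phi b, flat_at psi a & flat_at psi b],
    forall k x, (k < p)%N -> a <= x <= b ->
      `|phi k x| <= b - a /\ `|psi k x| <= b - a &
    forall Y, area_primitive (fun k x => f k x + phi k x)
        (fun k x => g k x + psi k x) Y ->
      2 * (Y b - Y a) = 2 * (X b - X a) + T].

Lemma corrects_of_primitive f g X p a b T (phi psi : nat -> R -> R) N :
  jet f -> jet g -> area_primitive f g X -> jet phi /\ jet psi ->
  [/\ flat_at phi a, flat_at phi b, flat_at psi a & flat_at psi b] ->
  (forall k x, (k < p)%N -> a <= x <= b ->
     `|phi k x| <= b - a /\ `|psi k x| <= b - a) ->
  (forall x, is_derive x (1 : R) N (2 * (f 1%N x * psi 0%N x - phi 0%N x * g 1%N x)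
     + (phi 1%N x * psi 0%N x - phi 0%N x * psi 1%N x))) ->
  2 * (N b - N a) = T -> corrects f g X p a b T.
Proof.
move=> jf jg pX [jp jq] fpq B dN E; have [pa pb qa qb] := fpq.
exists phi, psi; split=> // Y pY.
by rewrite (perturbed_area jf jg jp jq pa pb qa qb pX pY dN) mulrDr E.
Qed.

(** Serves the gaps that are too long for any size control. D can be as large as needed, and D >= 1
    gives D <= D^2. *)
Lemma corrects_any f g X a b T : jet f -> jet g -> area_primitive f g X ->
  a < b -> corrects f g X 0 a b T.
Proof.
move=> jf jg pX ab; have [th [Bt [jt t0 t1 tp BtE]]] := step_function R.
have [S1 S10 fS] := jet_bounded 1 a b jf.
have [S2 S20 gS] := jet_bounded 1 a b jg.
pose D := 4 * (S1 + S2) * Bt 1%N * (b - a) + `|T| + 1.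
have D0 : 0 <= 4 * (S1 + S2) * Bt 1%N * (b - a).
  have [B0 _] := BtE 1%N; apply: mulr_ge0; last by rewrite subr_ge0 ltW.
  by apply: mulr_ge0; [lra|exact: ltW].
have hf x : a <= x <= b -> `|f 1%N x| <= S1 + S2 by move=> /fS; lra.
have hg x : a <= x <= b -> `|g 1%N x| <= S1 + S2 by move=> /gS; lra.
have h1 : 4 * (S1 + S2) * Bt 1%N * (b - a) <= D.
  by rewrite /D; have := normr_ge0 T; lra.
have h2 : `|T| / 2 <= D ^+ 2.
  have T0 := normr_ge0 T.
  have D1 : 1 <= D by rewrite /D; lra.
  have : D <= D ^+ 2 by rewrite expr2 ler_peMr//; lra.
  by move: (D ^+ 2) => z; rewrite /D; lra.
have [phi [psi [N [jpq fpq _ dN E]]]] := bump_quadratic jt t0 t1 tp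
  (fun k => (BtE k).1) (fun k => (BtE k).2) jf jg ab hf hg h1 h2.
exact: corrects_of_primitive dN E.
Qed.

Lemma small_scale (A1 A2 A3 : R) : 0 < A1 -> 0 < A2 -> 0 < A3 ->
  exists2 delta : R, 0 < delta & forall l, 0 < l -> l < delta ->
    [/\ l <= 1 / 2, A1 * l <= 1 / 2, 4 * (A2 * l) <= 1 & A3 * l <= 1].
Proof.
move=> A10 A20 A30; have A0 : 0 < 2 + 2 * A1 + 4 * A2 + A3 by lra.
exists (2 + 2 * A1 + 4 * A2 + A3)^-1 => [|l l0]; first by rewrite invr_gt0.
move=> ld; have : (2 + 2 * A1 + 4 * A2 + A3) * l < 1 by rewrite -ltr_pdivlMl// mulr1.
have := mulr_gt0 A10 l0; have := mulr_gt0 A20 l0; have := mulr_gt0 A30 l0.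
by split; lra.
Qed.

(* If some first derivative exceeds l^(p+1) on a gap of length l, bend the other
   coordinate near that point: the area responds linearly, and assumption 3 at a
   high order makes the deficit negligible.  Otherwise the deficit at order p+1
   is small enough to be absorbed by the area of a small loop. *)
Lemma corrects_small f g X c d p (G : R -> R -> Prop) (T : R -> R -> R) :
  jet f -> jet g -> area_primitive f g X ->
  (forall a b, G a b -> [/\ c <= a, a < b & b <= d]) ->
  (forall m, exists2 C : R, 0 < C &
     forall a b, G a b -> `|T a b| <= C * velocity f g m a b) ->
  exists2 delta : R, 0 < delta &
    forall a b, G a b -> b - a < delta -> corrects f g X p a b (T a b).
Proof.
move=> jf jg pX Gab TV; have [th [Bt [jt t0 t1 tp BtE]]] := step_function R.
have common k c' d' : exists2 M : R, 0 < M & forall x, c' <= x <= d' ->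
    `|f k x| <= M /\ `|g k x| <= M.
  have [Mf Mf0 fM] := jet_bounded k c' d' jf.
  have [Mg Mg0 gM] := jet_bounded k c' d' jg.
  exists (Mf + Mg) => [|x xcd]; first by rewrite addr_gt0.
  by have := fM _ xcd; have := gM _ xcd; lra.
pose q := p.+1.
(* On a gap of length l <= 1 the velocity of order m is O(l^(m+1)); this is the exponent that
   [linear_correction] consumes. *)
have [m mE] : exists m, m.+1 = ((q + 2) * p + 2 + (2 * q + 2))%N.
  by exists ((q + 2) * p + 2 + (2 * q + 1))%N; lia.
have qq : (2 * q + 2 = q.+1 + q.+1)%N by lia.
have [S S0 HS] := common 1%N c d.
have [B2 B20 HB2] := common 2%N (c - 1) (d + 1).
have [Bq Bq0 HBq] := common q.+1 c d.
have [Bm Bm0 HBm] := common m.+1 c d.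
have [Cq Cq0 HCq] := TV q; have [Cm Cm0 HCm] := TV m.
pose BB := bump_bound Bt p.
have BB0 : 0 < BB by apply: bump_bound_gt0 => k; case: (BtE k).
pose C1 := Cm * (1 + 2 * (S + Bm)).
have C10 : 0 < C1 by rewrite mulr_gt0//; lra.
(* From [velocity_le] with s = l^q: the coefficient of l^(2q+2) is 1 + 2 (1 + Bq). *)
pose C2 := Cq * (3 + 2 * Bq).
have C20 : 0 < C2 by rewrite mulr_gt0//; lra.
have K0 : 0 < 1 + C2 + 4 * Bt 1%N by have [B10 _] := BtE 1%N; lra.
have [delta delta0 Hdelta] := small_scale B20 (mulr_gt0 K0 BB0) (mulr_gt0 C10 BB0).
exists delta => // a b Gg ld; have [ca ab bd] := Gab _ _ Gg.
have : 0 < b - a by rewrite subr_gt0.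
move: ld; set l := b - a => ld l0.
have [l2 lB2 lK lC] := Hdelta l l0 ld.
have l1 : l <= 1 by apply: le_trans l2 _; rewrite ler_pdivrMr// mul1r ler1n.
have xcd x : a <= x <= b -> c <= x <= d.
  by move=> /andP[ax xb]; rewrite (le_trans ca ax) (le_trans xb bd).
have lX i : 0 <= l ^+ i by rewrite exprn_ge0// ltW.
have lXle i j : (i <= j)%N -> l ^+ j <= l ^+ i.
  by move=> ij; apply: ler_wiXn2l; [exact: ltW|exact: l1|].
have Tm : `|T a b| <= C1 * l ^+ ((q + 2) * p + 2 + (2 * q + 2)).
  apply: le_trans (HCm _ _ Gg) _; rewrite /C1 -mulrA ler_wpM2l ?(ltW Cm0)//.
  apply: le_trans (velocity_le jf jg ab
     (fun x h => (HBm x (xcd x h)).1) (fun x h => (HBm x (xcd x h)).2)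
     (fun x h => (HS x (xcd x h)).1) (fun x h => (HS x (xcd x h)).2)) _.
  rewrite -mE -/l [leRHS]mulrDl mul1r lerD//.
    by apply: lXle; rewrite mul2n -addnn addn2 !ltnS leqW// leq_addr.
  rewrite [leRHS]mulrC ler_wpM2l//.
  have h1 : Bm * l ^+ m <= Bm.
    by rewrite ler_piMr ?(ltW Bm0)//; exact: (lXle 0%N m).
  have h0 : 0 <= 2 * (S + Bm * l ^+ m).
    by rewrite mulr_ge0// addr_ge0 ?mulr_ge0 ?(ltW S0) ?(ltW Bm0).
  apply: le_trans (ler_piMr h0 l1) _.
  by rewrite ler_wpM2l// lerD2l.
have ball2 x : a - 1 <= x <= b + 1 -> c - 1 <= x <= d + 1.
  move=> /andP[ax xb].
  by rewrite (le_trans _ ax) ?lerD2r// (le_trans xb) ?lerD2r.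
have Bt0 k := (BtE k).1; have BtB k := (BtE k).2.
have [[x0 x0ab fx0]|nf] := pselect (exists2 x0, a <= x0 <= b & l ^+ q < `|f 1%N x0|).
  have [psi [n [jp pa pb pB [dn E]]]] := linear_correction jt t0 t1 tp Bt0 BtB jf ab
    l2 (ltW B20) lB2 (ltW C10) lC (fun x h => (HB2 x (ball2 x h)).1) x0ab fx0 Tm.
  apply: (@corrects_of_primitive _ _ _ _ _ _ _ (fun _ _ => 0) psi (fun x => 2 * n x)) => //.
  - by split=> // k x; exact: is_derive_const.
  - by move=> k x kp _; rewrite normr0 (ltW l0) pB.
  - by move=> x; apply: is_derive_eq (is_derive_scale 2 (dn x)) _; ring.
  - by rewrite -E; ring.
have [[x0 x0ab gx0]|ng] := pselect (exists2 x0, a <= x0 <= b & l ^+ q < `|g 1%N x0|).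
  have [psi [n [jp pa pb pB [dn E]]]] := linear_correction jt t0 t1 tp Bt0 BtB jg ab
    l2 (ltW B20) lB2 (ltW C10) lC (fun x h => (HB2 x (ball2 x h)).2) x0ab gx0 Tm.
  (* The sign comes from the antisymmetry of the area: phi enters N' through - phi g'. *)
  apply: (@corrects_of_primitive _ _ _ _ _ _ _ (fun k x => -1 * psi k x) (fun _ _ => 0)
    (fun x => 2 * n x)) => //.
  - by split; [exact: jet_scale|move=> k x; exact: is_derive_const].
  - by split=> // k; rewrite ?pa ?pb mulr0.
  - by move=> k x kp _; rewrite normr0 mulN1r normrN (ltW l0) pB.
  - by move=> x; apply: is_derive_eq (is_derive_scale 2 (dn x)) _; ring.
  - by rewrite -E; ring.
have hf x : a <= x <= b -> `|f 1%N x| <= l ^+ q.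
  by move=> xab; rewrite leNgt; apply/negP => h; apply: nf; exists x.
have hg x : a <= x <= b -> `|g 1%N x| <= l ^+ q.
  by move=> xab; rewrite leNgt; apply/negP => h; apply: ng; exists x.
have Tq : `|T a b| <= C2 * l ^+ (2 * q + 2).
  apply: le_trans (HCq _ _ Gg) _; rewrite -mulrA ler_wpM2l ?(ltW Cq0)//.
  apply: le_trans (velocity_le jf jg ab
     (fun x h => (HBq x (xcd x h)).1) (fun x h => (HBq x (xcd x h)).2) hf hg) _.
  rewrite -/l qq exprD exprS; move: (l ^+ q) => z.
  by rewrite le_eqVlt; apply/orP; left; apply/eqP; ring.
have [phi [psi [N [jpq fpq B dN E]]]] := quadratic_correction jt t0 t1 tp Bt0 BtB jf jg ab
  l1 (ltW C20) lK hf hg Tq.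
exact: corrects_of_primitive B dN E.
Qed.

End Correction.

(** * Whitney fields on a compact set *)

Section Backward.
Variable R : realType.
Implicit Types (K E : set R) (F G H f g h : nat -> R -> R) (a b x y : R).

Lemma within_compact_bounded K (f : R -> R) : compact K ->
  {within K, continuous f} -> exists M : R, forall x, K x -> `|f x| <= M.
Proof.
move=> cK cf; have : bounded_set (f @` K).
  by apply: compact_bounded; exact: continuous_compact.
move=> [M [_ HM]]; exists (M + 1) => x Kx.
by apply: (HM (M + 1)); [rewrite ltrDl|exists x].
Qed.

(** The Whitney condition of class k + n, with eps = 1, has one more Taylor term; that term is
    itself O([|b - a|^n]) because F (k + n) is bounded on K. *)
Lemma whitney_field_taylor K F : compact K ->
  (forall m, whitney_field m K F) -> taylor_field K F.
Proof.
move=> cK W k n.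
have [M HM] := within_compact_bounded cK ((W (k + n)%N).1 (k + n)%N (leqnn _)).
have [d d0 Hd] := (W (k + n)%N).2 k (leq_addr _ _) 1 ltr01.
have C0 : 0 < 1 + `|M| + d^-1 by rewrite ltr_wpDl ?invr_gt0// addr_ge0.
exists (1 + `|M| + d^-1) => // a b Ka Kb; rewrite -ltr_pdivlMl// mulr1 => ba.
have bd : `|b - a| < d.
  apply: lt_le_trans ba _; rewrite -[leRHS]invrK lef_pV2 ?posrE ?invr_gt0//.
  by rewrite lerDr addr_ge0.
have := Hd a b Ka Kb bd; rewrite /whitney_remainder addKn mul1r big_ord_recr /=.
set S := \sum_(l < n) _; set z := _ * (b - a) ^+ n => H1.
have H2 : `|z| <= `|M| * `|b - a| ^+ n.
  rewrite /z normrM normrX ler_wpM2r ?exprn_ge0//.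
  rewrite normrM normfV (ger0_norm (x := n`!%:R))//.
  apply: (@le_trans _ _ `|F (k + n)%N a|).
    by rewrite ler_piMr// invf_le1 ?ltr0n ?fact_gt0// ler1n fact_gt0.
  exact: le_trans (HM a Ka) (ler_norm M).
rewrite (_ : F k b - S = (F k b - (S + z)) + z); last by ring.
rewrite (le_trans (ler_normD _ _))//.
have : 0 <= d^-1 * `|b - a| ^+ n by rewrite mulr_ge0 ?exprn_ge0// invr_ge0 ltW.
lra.
Qed.

(** A zero derivative on E does not prevent jumps across gaps, so these are excluded separately. For
    each slope eps, the supremum s of the points reached from x belongs to S; if s < y, a gap
    starting at s or points of E accumulating at s give a further point. *)
Lemma constant_on_closed E (D : R -> R) : closed E ->
  (forall x, E x -> forall eps : R, 0 < eps -> exists2 delta : R, 0 < delta &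
     forall y, E y -> `|y - x| < delta -> `|D y - D x| <= eps * `|y - x|) ->
  (forall a b, gap E a b -> D a = D b) ->
  forall x y, E x -> E y -> D x = D y.
Proof.
move=> cE dD gD.
suff lem x y : E x -> E y -> x < y -> D x = D y.
  move=> x y Ex Ey; have [xy|yx|->//] := ltgtP x y; first exact: lem.
  by rewrite (lem y x).
move=> Ex Ey xy; apply/eqP; rewrite eq_sym -subr_eq0 -normr_le0.
apply/ler_addgt0Pr => e e0; rewrite add0r.
pose eps := e / (y - x); have eps0 : 0 < eps by rewrite divr_gt0// subr_gt0.
suff : `|D y - D x| <= eps * (y - x) by rewrite divfK// subr_eq0 gt_eqF.
pose S := [set z | E z /\ (x <= z <= y /\ `|D z - D x| <= eps * (z - x))].
have Sx : S x.
  by split=> //; split; [rewrite lexx ltW|rewrite !subrr normr0 mulr0].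
have sS : has_sup S by split; [exists x|exists y => z [_ [/andP[_]]]].
set s := sup S.
have sle z : S z -> z <= s by move=> Sz; exact: sup_upper_bound.
have sy : s <= y by apply: ge_sup; [exists x|move=> z [_ [/andP[_]]]].
have xs := sle _ Sx.
have Es : E s.
  apply: contrapT => /(closed_has_ball cE)[d d0 Hd].
  have [z Sz zd] := sup_adherent d0 sS.
  have zs := sle _ Sz; rewrite -/s in zd.
  by case: Sz => Ez _; apply: (Hd z) => //; rewrite ltr_norml; lra.
have Ds : `|D s - D x| <= eps * (s - x).
  have [d d0 Hd] := dD s Es eps eps0.
  have [z Sz zd] := sup_adherent d0 sS; have zs := sle _ Sz; rewrite -/s in zd.
  case: Sz => Ez [xz Dz].
  have /(Hd z Ez) : `|z - s| < d by rewrite ltr_norml; lra.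
  rewrite distrC (distrC z) (ger0_norm (x := s - z)) ?subr_ge0// => h.
  rewrite (_ : D s - D x = (D s - D z) + (D z - D x)); last ring.
  by rewrite (le_trans (ler_normD _ _))//; lra.
have [<-//|sy'] := eqVneq s y.
have {}sy : s < y by rewrite lt_neqAle sy'.
exfalso; have [|[b gb]|acc] := gap_right cE Es _; first by exists y.
  have [_ Eb sb _] := gb.
  have by' : b <= y by case: (gap_out gb Ey); lra.
  have : S b.
    split=> //; split; first lra.
    rewrite -(gD _ _ gb); apply: le_trans Ds _; rewrite ler_wpM2l ?(ltW eps0)//; lra.
  by move=> /sle; lra.
have [d d0 Hd] := dD s Es eps eps0.
have m0 : 0 < Num.min d (y - s) by rewrite lt_min d0 subr_gt0.
have [z Ez szd] := acc _ m0.
have : z - s < Num.min d (y - s) by lra.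
rewrite lt_min => /andP[z1 z2].
have /(Hd z Ez) : `|z - s| < d by rewrite ltr_norml; lra.
rewrite (ger0_norm (x := z - s)); last lra.
move=> h; have : S z.
  split=> //; split; first lra.
  rewrite (_ : D z - D x = (D z - D s) + (D s - D x)); last ring.
  by rewrite (le_trans (ler_normD _ _))//; lra.
by move=> /sle; lra.
Qed.

Lemma taylor_poly_congr f F m a : (forall k, f k a = F k a) ->
  taylor_poly f m a = taylor_poly F m a.
Proof. by move=> fa; apply: eq_bigr => k _; rewrite fa. Qed.

Lemma area_discrepancy_congr f g h F G H m a b :
  (forall k, f k a = F k a) -> (forall k, g k a = G k a) ->
  f 0%N b = F 0%N b -> g 0%N b = G 0%N b ->
  h 0%N a = H 0%N a -> h 0%N b = H 0%N b ->
  area_discrepancy f g h m a b = area_discrepancy F G H m a b.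
Proof.
move=> fa ga fb gb ha hb; rewrite /area_discrepancy.
by rewrite (taylor_poly_congr m fa) (taylor_poly_congr m ga) fa ga fb gb ha hb.
Qed.

Lemma velocity_congr f g F G m a b :
  (forall k, f k a = F k a) -> (forall k, g k a = G k a) ->
  velocity f g m a b = velocity F G m a b.
Proof.
move=> fa ga.
by rewrite /velocity (taylor_poly_congr m fa) (taylor_poly_congr m ga).
Qed.

Lemma bounded_max (P : nat -> Prop) N : P 0%N ->
  exists p, P p /\ forall q, (q <= N)%N -> P q -> (q <= p)%N.
Proof.
move=> P0; elim: N => [|N [p [Pp Hp]]].
  by exists 0%N; split=> // q; rewrite leqn0 => /eqP ->.
have [PN|nPN] := pselect (P N.+1); first by exists N.+1.
exists p; split=> // q; rewrite leq_eqVlt => /predU1P[->//|]; exact: Hp.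
Qed.

Lemma jet_abs_continuous f : jet f -> abs_continuous (f 0%N).
Proof.
move=> jf c d eps e0; have [M M0 HM] := jet_bounded 1 c d jf.
exists (eps / M) => [|n u v uv _ sm]; first by rewrite divr_gt0.
apply: (@le_lt_trans _ _ (M * \sum_i (v i - u i))); last first.
  by rewrite mulrC -ltr_pdivlMr.
rewrite mulr_sumr; apply: ler_sum => i _; have [cu [uvi vd]] := uv i.
rewrite -[v i - u i]ger0_norm ?subr_ge0//.
by apply: (ler_mvt (jf 0%N)) => x xx; apply: HM; case/orP: xx; lra.
Qed.

Lemma jet_horizontal f g h : jet f -> jet g -> jet h ->
  (forall x, h 1%N x = 2 * (f 1%N x * g 0%N x - g 1%N x * f 0%N x)) ->
  horizontal (f 0%N) (g 0%N) (h 0%N).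
Proof.
move=> jf jg jh hE; split; try exact: jet_abs_continuous.
apply: aeW => t; have d1 := jf 0%N t; have d2 := jg 0%N t; have d3 := jh 0%N t.
split; [exact: (@ex_derive _ _ _ _ _ _ _ d1)|exact: (@ex_derive _ _ _ _ _ _ _ d2)|
  exact: (@ex_derive _ _ _ _ _ _ _ d3)|].
exists (f 1%N t), (g 1%N t); rewrite !derive1E.
rewrite (@derive_val _ _ _ _ _ _ _ d1) (@derive_val _ _ _ _ _ _ _ d2)
  (@derive_val _ _ _ _ _ _ _ d3) hE.
transitivity (f 1%N t * 1 + g 1%N t * 0, f 1%N t * 0 + g 1%N t * 1,
    f 1%N t * (2 * g 0%N t) + g 1%N t * - (2 * f 0%N t)); last by [].
by congr (_, _, _); ring.
Qed.

End Backward.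

(** * Horizontal extension *)

Section BackwardMain.
Variable R : realType.
Implicit Types (K E : set R) (F G H f g h : nat -> R -> R) (a b x y : R).

(** The half-lines leave only bounded complementary intervals. With L = A + 1 they lie at distance
    at least 1 from K, so a gap shorter than 1 has both ends in K. *)
Definition with_rays K (L : R) : set R :=
  K `|` ([set x | x <= - L] `|` [set x | L <= x]).

Section WithRays.
Variables (K : set R) (A : R).
Hypotheses (cK : compact K) (A0 : 0 <= A) (KA : forall x, K x -> `|x| <= A).
Let E := with_rays K (A + 1).

Lemma with_rays_closed : closed E.
Proof.
apply: closedU; first exact: compact_closed (@norm_hausdorff _ _) cK.
by apply: closedU; [exact: closed_le|exact: closed_ge].
Qed.

Lemma with_rays_lt x : exists2 e, E e & e < x.
Proof.
exists (Num.min (- (A + 1)) (x - 1)); last by rewrite gt_min; apply/orP; right; lra.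
by right; left; rewrite /= ge_min lexx.
Qed.

Lemma with_rays_gt x : exists2 e, E e & x < e.
Proof.
exists (Num.max (A + 1) (x + 1)); last by rewrite lt_max; apply/orP; right; lra.
by right; right; rewrite /= le_max lexx.
Qed.

Lemma gap_with_rays a b : gap K a b -> gap E a b.
Proof.
move=> [Ka Kb ab H]; split=> //; [by left|by left|].
move=> x xab [Kx|[] /= h]; first exact: H xab Kx.
  by have := KA Ka; rewrite ler_norml; lra.
by have := KA Kb; rewrite ler_norml; lra.
Qed.

Lemma with_rays_short_gap a b : gap E a b -> b - a < 1 -> K a /\ K b.
Proof.
move=> [Ea Eb ab H] ba.
have mid : a < (a + b) / 2 < b by lra.
have := H _ mid; move=> nE.
case: Ea Eb => [Ka|[/= al|/= al]] [Kb|[/= bl|/= bl]] //.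
- by have := KA Ka; rewrite ler_norml; lra.
- by have := KA Ka; rewrite ler_norml; lra.
- by have := KA Kb; rewrite ler_norml; lra.
- by exfalso; apply: nE; right; left => /=; lra.
- by exfalso; have := A0; lra.
- by have := KA Kb; rewrite ler_norml; lra.
- by exfalso; have := A0; lra.
- by exfalso; apply: nE; right; right => /=; lra.
Qed.

Lemma jet_extension F : (forall m, whitney_field m K F) ->
  exists2 f, jet f & forall k x, K x -> f k x = F k x.
Proof.
move=> W; pose F' k x := if `[< K x >] then F k x else 0.
have FK k x : K x -> F' k x = F k x by move=> Kx; rewrite /F' asboolT.
have F0 k x : ~ K x -> F' k x = 0 by move=> Kx; rewrite /F' asboolF.
have [||f jf fE] := @whitney_extension R E F' with_rays_closed with_rays_lt with_rays_gt.
- move=> k; have [M HM] := within_compact_bounded cK ((W k).1 k (leqnn k)).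
  exists `|M| => x _; have [Kx|nKx] := pselect (K x).
    by rewrite FK// (le_trans (HM x Kx))// ler_norm.
  by rewrite F0// normr0.
- move=> k n; have [C C0 HC] := whitney_field_taylor cK W k n.
  (* The added 1 forces [|b - a| < 1]: both points lie in K or both lie in the half-lines, where the
     field is 0. *)
  exists (C + 1) => [|a b Ea Eb ba]; first lra.
  have ab0 := normr_ge0 (b - a).
  have Cab : 0 <= C * `|b - a| by rewrite mulr_ge0// ltW.
  have n0 : 0 <= `|b - a| ^+ n by rewrite exprn_ge0.
  have C'0 : 0 <= C * `|b - a| ^+ n by rewrite mulr_ge0// ltW.
  have h1 : C * `|b - a| < 1 by move: ba; rewrite mulrDl; lra.
  have h2 : `|b - a| < 1 by move: ba; rewrite mulrDl; lra.
  have : (K a /\ K b) \/ (~ K a /\ ~ K b).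
    have nK x : (x <= - (A + 1)) \/ (A + 1 <= x) -> ~ K x.
      by move=> xl /KA; rewrite ler_norml; case: xl; lra.
    move: h2; rewrite ltr_norml => h2.
    case: Ea Eb => [Ka|al] [Kb|bl]; [by left| | |by right; split; exact: nK].
    - by have := KA Ka; rewrite ler_norml; case: bl => /=; lra.
    - by have := KA Kb; rewrite ler_norml; case: al => /=; lra.
  move=> [[Ka Kb]|[Ka Kb]].
    under eq_bigr do rewrite FK//.
    by rewrite FK// (le_trans (HC a b Ka Kb h1))// mulrDl mul1r lerDl.
  under eq_bigr do rewrite F0//.
  rewrite big1 ?F0// ?subrr ?normr0 ?mulr_ge0//; first by rewrite addr_ge0// ltW.
  by move=> i _; rewrite !mul0r.
by exists f => // k x Kx; rewrite fE ?FK//; left.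
Qed.

End WithRays.

Lemma area_primitive_jet f g X (c : R) : jet f -> jet g -> area_primitive f g X ->
  jet (fun k x => if k is j.+1
    then 2 * (jmul (fun i => f (1 + i)%N) g j x - jmul (fun i => g (1 + i)%N) f j x)
    else 2 * X x + c).
Proof.
move=> jf jg pX [|k] x.
  have := is_derive_add (is_derive_scale 2 (pX x)) (is_derive_const x c).
  by move=> /is_derive_eq; apply; rewrite /jmul !big_ord1 !bin0 !subnn; ring.
apply: is_derive_scale.
by apply: jet_sub; apply: jet_mul => //; exact: jet_shift.
Qed.

(** Brings the Leibniz jet of f'g - g'f to the form of assumption 2 with m = j + 1. *)
Lemma jmul_shift f g j x :
  jmul (fun i => f (1 + i)%N) g j x - jmul (fun i => g (1 + i)%N) f j x =
  \sum_(i < j.+1) 'C(j, i)%:R * (f (j.+1 - i)%N x * g i x - g (j.+1 - i)%N x * f i x).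
Proof.
rewrite /jmul -sumrB; apply: eq_bigr => i _.
by rewrite -mulrBr add1n subSn// -ltnS.
Qed.

Lemma horizontal_extension K F G H (C : nat -> R) : compact K ->
  (forall m, [/\ whitney_field m K F, whitney_field m K G & whitney_field m K H]) ->
  (forall m, (1 <= m)%N -> forall x, K x ->
     H m x = 2 * \sum_(i < m) 'C(m.-1, i)%:R *
                    (F (m - i)%N x * G i x - G (m - i)%N x * F i x)) ->
  (forall m, 0 < C m) ->
  (forall m a b, K a -> K b -> a < b ->
     `|area_discrepancy F G H m a b| <= C m * velocity F G m a b) ->
  exists f g h, [/\ jet f, jet g, jet h,
    forall x, h 1%N x = 2 * (f 1%N x * g 0%N x - g 1%N x * f 0%N x) &
    forall k x, K x -> [/\ f k x = F k x, g k x = G k x & h k x = H k x]].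
Proof.
move=> cK W HE C0 AV.
have WF m : whitney_field m K F by case: (W m).
have WG m : whitney_field m K G by case: (W m).
have WH m : whitney_field m K H by case: (W m).
have [A A0 KA] : exists2 A : R, 0 <= A & forall x, K x -> `|x| <= A.
  have [|M HM] := @within_compact_bounded R K id cK.
    by apply: continuous_subspaceT => x; exact: cvg_id.
  by exists `|M| => // x Kx; rewrite (le_trans (HM x Kx))// ler_norm.
pose E := with_rays K (A + 1).
have [f jf fK] := jet_extension cK KA WF.
have [g jg gK] := jet_extension cK KA WG.
have [X pX] := area_primitive_exists jf jg.
pose T a b := H 0%N b - H 0%N a - 2 * (X b - X a).
pose S a b := [/\ K a, K b & a < b].
have small p : exists2 delta : R, 0 < delta & forall a b, S a b ->
    b - a < delta -> corrects f g X p a b (T a b).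
  apply: (@corrects_small R f g X (- A) A p S T jf jg pX).
    move=> a b [/KA + /KA + ab]; rewrite !ler_norml; split; lra.
  move=> m; have [C' C'0 HC'] := @area_estimate R f g m (- A) A jf jg.
  exists (C m + C') => [|a b [Ka Kb ab]]; first by rewrite addr_gt0.
  have /andP[_ bA] : - A <= b <= A by rewrite -ler_norml; exact: KA.
  have /andP[aA _] : - A <= a <= A by rewrite -ler_norml; exact: KA.
  have := HC' a b H X aA ab bA pX; rewrite -/(T a b).
  have fa k : f k a = F k a by exact: fK.
  have ga k : g k a = G k a by exact: gK.
  rewrite (@area_discrepancy_congr R f g H F G H m a b fa ga (fK _ _ Kb) (gK _ _ Kb))//.
  rewrite (velocity_congr m b fa ga) => h1; have h2 := AV m a b Ka Kb ab.
  have := ler_normB (area_discrepancy F G H m a b)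
    (area_discrepancy F G H m a b - T a b).
  by rewrite subKr => /le_trans; apply; rewrite mulrDl lerD.
(* On each gap, use a correction with the largest available order, up to the
   inverse of the length of the gap. *)
have /choice[Phi PhiP] : forall ab : R * R, exists Phi : (nat -> R -> R) * (nat -> R -> R),
    gap E ab.1 ab.2 ->
    [/\ jet Phi.1 /\ jet Phi.2,
      [/\ flat_at Phi.1 ab.1, flat_at Phi.1 ab.2, flat_at Phi.2 ab.1 & flat_at Phi.2 ab.2],
      forall k q x, (k < q)%N -> (q <= Num.truncn (ab.2 - ab.1)^-1)%N ->
        corrects f g X q ab.1 ab.2 (T ab.1 ab.2) -> ab.1 <= x <= ab.2 ->
        `|Phi.1 k x| <= ab.2 - ab.1 /\ `|Phi.2 k x| <= ab.2 - ab.1 &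
      forall Y, area_primitive (fun k x => f k x + Phi.1 k x)
          (fun k x => g k x + Phi.2 k x) Y ->
        2 * (Y ab.2 - Y ab.1) = H 0%N ab.2 - H 0%N ab.1].
  move=> [a b] /=; have [gab|ngab] := pselect (gap E a b); last first.
    by exists (fun _ _ => 0, fun _ _ => 0).
  have [_ _ ab _] := gab.
  have [p [Pp Hp]] := @bounded_max (fun p => corrects f g X p a b (T a b))
     (Num.truncn (b - a)^-1) (corrects_any (T a b) jf jg pX ab).
  have [phi [psi [jpq fpq bpq apq]]] := Pp.
  exists (phi, psi) => _; split=> //=.
    by move=> k q x kq qN qc xab; apply: bpq => //; apply: leq_trans kq _; exact: Hp.
  by move=> Y /apq ->; rewrite /T; ring.
have sm k (eps : R) : 0 < eps -> exists2 delta : R, 0 < delta &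
    forall a b, gap E a b -> b - a < delta -> forall x, a <= x <= b ->
      `|(Phi (a, b)).1 k x| <= eps /\ `|(Phi (a, b)).2 k x| <= eps.
  move=> e0; have [d d0 Hd] := small k.+1.
  (* Below d a correction of order k + 1 exists; below 1/(k + 1) that order is among the candidates
     for the maximum, and both ends are in K; eps is the bound wanted. *)
  exists (Num.min d (Num.min k.+1%:R^-1 eps)) => [|a b gab].
    by rewrite !lt_min d0 e0 invr_gt0 ltr0n.
  rewrite !lt_min => /and3P[ld lk le] x xab; have [_ _ ab _] := gab.
  have l1 : b - a < 1.
    by apply: lt_le_trans lk _; rewrite invf_le1 ?ltr0n// ler1n.
  have [Ka Kb] := with_rays_short_gap A0 KA gab l1.
  have [_ _ /(_ k k.+1 x (ltnSn k))/= B _] := PhiP (a, b) gab.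
  have [||h1 h2] := B _ _ xab.
  - have ab0 : 0 < b - a by rewrite subr_gt0.
    rewrite truncn_ge_nat ?invr_ge0 ?(ltW ab0)//.
    by rewrite -[leLHS]invrK lef_pV2 ?posrE ?invr_gt0 ?ltr0n// ltW.
  - exact: Hd.
  by split; [exact: le_trans h1 (ltW le)|exact: le_trans h2 (ltW le)].
have cE : closed E := with_rays_closed cK.
(* The corrections are glued with the zero field on E, so the jets on K do not change. *)
have W0 : whitney_differentiable E (fun _ _ => 0 : R).
  move=> k x _ eps e0; exists 1 => // y _ _.
  by rewrite !subrr mul0r subrr normr0 mulr_ge0// ltW.
have [||phi [jp p0 pg]] := @glue_jets R E (fun _ _ => 0) (fun a b => (Phi (a, b)).1)
    cE (with_rays_lt K A) (with_rays_gt K A) W0.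
- by move=> a b /(PhiP (a, b))[[? ?] [? ? ? ?] _ _].
- move=> k eps e0; have [d d0 Hd] := sm k eps e0; exists d => // a b gab ba x xab.
  by rewrite subr0; have [] := Hd a b gab ba x xab.
have [||psi [jq q0 qg]] := @glue_jets R E (fun _ _ => 0) (fun a b => (Phi (a, b)).2)
    cE (with_rays_lt K A) (with_rays_gt K A) W0.
- by move=> a b /(PhiP (a, b))[[? ?] [? ? ? ?] _ _].
- move=> k eps e0; have [d d0 Hd] := sm k eps e0; exists d => // a b gab ba x xab.
  by rewrite subr0; have [] := Hd a b gab ba x xab.
have KE x : K x -> E x by left.
pose f' k x := f k x + phi k x; pose g' k x := g k x + psi k x.
have jf' : jet f' by exact: jet_add.
have jg' : jet g' by exact: jet_add.
have fK' k x : K x -> f' k x = F k x.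
  by move=> Kx; rewrite /f' fK// p0 ?addr0//; exact: KE.
have gK' k x : K x -> g' k x = G k x.
  by move=> Kx; rewrite /g' gK// q0 ?addr0//; exact: KE.
have [Y pY] := area_primitive_exists jf' jg'.
have Ygap a b : gap K a b -> 2 * (Y b - Y a) = H 0%N b - H 0%N a.
  move=> /(gap_with_rays KA) gab; have [_ _ ab _] := gab.
  have [[j1 j2] _ _ Harea] := PhiP (a, b) gab; rewrite /= in j1 j2 Harea.
  have [Y' pY'] := area_primitive_exists (jet_add jf j1) (jet_add jg j2).
  rewrite -(Harea _ pY').
  have dYY x := is_derive_sub (pY x) (pY' x).
  (* On the gap the glued corrections are those of the gap, so both primitives have the same
     increment. *)
  have z x : a <= x <= b -> `|f' 1%N x * g' 0%N x - g' 1%N x * f' 0%N x -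
      ((f 1%N x + (Phi (a, b)).1 1%N x) * (g 0%N x + (Phi (a, b)).2 0%N x) -
      (g 1%N x + (Phi (a, b)).2 1%N x) * (f 0%N x + (Phi (a, b)).1 0%N x))| <= 0.
    move=> xab; rewrite /f' /g' !(pg a b _ x gab xab) !(qg a b _ x gab xab).
    by rewrite subrr normr0.
  have := ler_growth (ltW ab) dYY (fun x => is_derive_const x 0) z.
  rewrite subrr normr_le0 => /eqP; lra.
pose h c := fun k x => if k is j.+1
    then 2 * (jmul (fun i => f' (1 + i)%N) g' j x - jmul (fun i => g' (1 + i)%N) f' j x)
    else 2 * Y x + c.
have jh c : jet (h c) by exact: area_primitive_jet.
have hS c k x : K x -> h c k.+1 x = H k.+1 x.
  move=> Kx; rewrite /h jmul_shift HE//; congr (2 * _); apply: eq_bigr => i _.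
  by rewrite !fK' ?gK'.
have hconst x y : K x -> K y -> H 0%N x - 2 * Y x = H 0%N y - 2 * Y y.
  apply: (@constant_on_closed R K (fun x => H 0%N x - 2 * Y x)).
  - exact: compact_closed (@norm_hausdorff _ _) cK.
  - move=> {}x Kx eps e0.
    have e2 : 0 < eps / 2 by rewrite divr_gt0.
    have WD := taylor_field_differentiable (whitney_field_taylor cK WH).
    have [d1 d10 H1] := WD 0%N x Kx _ e2.
    have /is_derive_epsP/(_ _ e2)[d2 d20 H2] := jh 0 0%N x.
    rewrite (hS 0 0%N x Kx) in H2.
    exists (Num.min d1 d2) => [|{}y Ky]; first by rewrite lt_min d10.
    rewrite lt_min => /andP[/(H1 y Ky) h1 /H2 h2].
    rewrite (_ : _ - _ = (H 0%N y - H 0%N x - H 1%N x * (y - x)) -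
      (h 0 0%N y - h 0 0%N x - H 1%N x * (y - x))); last by rewrite /h; ring.
    by rewrite (le_trans (ler_normB _ _))//; lra.
  - by move=> a b /Ygap; lra.
have [c hc] : exists c, forall x, K x -> h c 0%N x = H 0%N x.
  have [[x0 Kx0]|nK] := pselect (exists x, K x); last first.
    by exists 0 => x Kx; exfalso; apply: nK; exists x.
  exists (H 0%N x0 - 2 * Y x0) => x Kx; have := hconst x x0 Kx Kx0.
  by rewrite /h; lra.
exists f', g', (h c); split=> // [x|k x Kx].
  by rewrite /h /jmul !big_ord1 !bin0 !subnn !mul1r.
by split; [exact: fK'|exact: gK'|case: k => [|k]; [exact: hc|exact: hS]].
Qed.

End BackwardMain.

(** * Restrictions of horizontal curves *)

Section Forward.
Variable R : realType.
Implicit Types (K E : set R) (F G H f g h : nat -> R -> R) (a b x y : R).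

(** If D t were nonzero, the negligible set would contain an interval ]t, t + d[ of positive
    measure. *)
Lemma ae_eq0_continuous (D : R -> R) : continuous D ->
  {ae (@lebesgue_measure R), forall t, D t = 0} -> forall t, D t = 0.
Proof.
move=> cD [N [mN N0 HN]] t; apply: contrapT => /eqP Dt0.
have e0 : 0 < `|D t| by rewrite normr_gt0.
have /cvgrPdist_lt/(_ _ e0)/nbhs_ballP[d /= d0 Hd] := cD t.
have sub : `]t, t + d[ `<=` N.
  move=> x /=; rewrite in_itv /= => /andP[tx xd]; apply: HN => /= Dx.
  have : ball t d x by rewrite /ball /= ltr_norml; lra.
  by move=> /Hd; rewrite Dx subr0 ltxx.
have : (lebesgue_measure `]t, (t + d)%R[ <= lebesgue_measure N)%E.
  by apply: le_measure => //; rewrite ?inE.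
rewrite N0 lebesgue_measure_itv /= lte_fin ltrDl d0 -EFinB lee_fin.
lra.
Qed.

Lemma horizontal_derivative f g h : jet f -> jet g -> jet h ->
  horizontal (f 0%N) (g 0%N) (h 0%N) ->
  forall x, h 1%N x = 2 * (f 1%N x * g 0%N x - g 1%N x * f 0%N x).
Proof.
move=> jf jg jh [_ _ _ hor] x; apply/eqP; rewrite -subr_eq0; apply/eqP.
move: x; apply: ae_eq0_continuous => [x|].
  exact: is_derive_continuous (is_derive_sub (jh 1%N x) (is_derive_scale 2
    (is_derive_sub (is_derive_mul (jf 1%N x) (jg 0%N x))
                   (is_derive_mul (jg 1%N x) (jf 0%N x))))).
apply: negligibleS hor => x + [_ _ _ [u [v E]]]; apply.
have := E; rewrite !derive1E.
rewrite (@derive_val _ _ _ _ _ _ _ (jf 0%N x)) (@derive_val _ _ _ _ _ _ _ (jg 0%N x))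
  (@derive_val _ _ _ _ _ _ _ (jh 0%N x)).
rewrite [RHS](_ : _ = (u * 1 + v * 0, u * 0 + v * 1,
  u * (2 * g 0%N x) + v * - (2 * f 0%N x))); last by [].
by case=> fE gE hE; rewrite /= fE gE hE; ring.
Qed.

Lemma jet_whitney_field K F f m : compact K ->
  (forall k, {within K, continuous (F k)}) -> jet f ->
  (forall k x, K x -> f k x = F k x) -> whitney_field m K F.
Proof.
move=> cK cF jf fK; split=> // k km eps e0.
have [A HA] : exists A : R, forall x, K x -> `|x| <= A.
  apply: (@within_compact_bounded R K id cK).
  by apply: continuous_subspaceT => x; exact: cvg_id.
have [M M0 HM] := jet_bounded m.+1 (- A) A jf.
exists (eps / M) => [|a b Ka Kb ba]; first by rewrite divr_gt0.
rewrite /whitney_remainder -(fK _ _ Kb).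
under eq_bigr do rewrite -fK//.
have H x : (a <= x <= b) || (b <= x <= a) -> `|f (k + (m - k).+1)%N x| <= M.
  move=> xab; rewrite addnS subnKC//; apply: HM.
  have /andP[aA aA'] : - A <= a <= A by rewrite -ler_norml; exact: HA.
  have /andP[bA bA'] : - A <= b <= A by rewrite -ler_norml; exact: HA.
  by case/orP: xab; lra.
have := taylor_bound (jet_shift k jf) H; rewrite addn0 => /le_trans; apply.
rewrite exprS mulrA ler_wpM2r ?exprn_ge0//.
by rewrite mulrC -ler_pdivlMr// ltW.
Qed.

End Forward.

Theorem theorem5p1 (R : realType) (K : set R) (F G H : nat -> R -> R)
    (compactK : compact K)
    (contF : forall k, {within K, continuous (F k)})
    (contG : forall k, {within K, continuous (G k)})
    (contH : forall k, {within K, continuous (H k)}) :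
  (exists f g h : R -> R,
    [/\ smooth f, smooth g, smooth h, horizontal f g h &
      forall (k : nat) (x : R), K x ->
        [/\ f^`(k) x = F k x, g^`(k) x = G k x & h^`(k) x = H k x]])
  <->
  (exists C : nat -> R,
    [/\ forall m : nat, 0 < C m,
        forall m : nat,
          [/\ whitney_field m K F, whitney_field m K G & whitney_field m K H],
        forall m : nat, (1 <= m)%N -> forall x : R, K x ->
          H m x = 2 * \sum_(i < m) 'C(m.-1, i)%:R *
                    (F (m - i)%N x * G i x - G (m - i)%N x * F i x) &
        forall (m : nat) (a b : R), K a -> K b -> a < b ->
          `|area_discrepancy F G H m a b| <= C m * velocity F G m a b]).
Proof.
split=> [[f [g [h [sf sg sh hor fK]]]]|[C [C0 W HE AV]]]; last first.
  have [f [g [h [jf jg jh hE fK]]]] := horizontal_extension compactK W HE C0 AV.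
  exists (f 0%N), (g 0%N), (h 0%N); split; try exact: smoothP.
    exact: jet_horizontal.
  by move=> k x Kx; rewrite !jet_smooth//; exact: fK.
have jf := smooth_jet sf; have jg := smooth_jet sg; have jh := smooth_jet sh.
have hE := horizontal_derivative jf jg jh hor.
have fF k x : K x -> f^`(k) x = F k x by move=> /(fK k)[].
have gG k x : K x -> g^`(k) x = G k x by move=> /(fK k)[].
have hH k x : K x -> h^`(k) x = H k x by move=> /(fK k)[].
have [A HA] : exists A : R, forall x, K x -> `|x| <= A.
  apply: (@within_compact_bounded R K id compactK).
  by apply: continuous_subspaceT => x; exact: cvg_id.
(* With h / 2 as area primitive, the quantity subtracted in [area_estimate] is 0. *)
have pX : area_primitive (fun k => f^`(k)) (fun k => g^`(k)) (fun x => 2^-1 * h x).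
  move=> x; apply: is_derive_eq (is_derive_scale 2^-1 (jh 0%N x)) _.
  by rewrite hE; field.
have /choice[C HC] : forall m, exists C : R, 0 < C /\ forall a b, K a -> K b -> a < b ->
    `|area_discrepancy F G H m a b| <= C * velocity F G m a b.
  move=> m; have [C C0 HC] := @area_estimate R _ _ m (- A) A jf jg.
  exists C; split=> // a b Ka Kb ab.
  have /andP[_ bA] : - A <= b <= A by rewrite -ler_norml; exact: HA.
  have /andP[aA _] : - A <= a <= A by rewrite -ler_norml; exact: HA.
  have := HC a b (fun k => h^`(k)) _ aA ab bA pX.
  rewrite derive1n0 (_ : h b - h a - 2 * (2^-1 * h b - 2^-1 * h a) = 0) ?subr0; last by field.
  rewrite (@area_discrepancy_congr R _ _ _ F G H m a b (fun k => fF k a Ka)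
    (fun k => gG k a Ka) (fF _ _ Kb) (gG _ _ Kb) (hH _ _ Ka) (hH _ _ Kb)).
  by rewrite (@velocity_congr R _ _ F G m a b (fun k => fF k a Ka) (fun k => gG k a Ka)).
exists C; split.
- by move=> m; case: (HC m).
- by move=> m; split; [exact: jet_whitney_field jf fF|exact: jet_whitney_field jg gG|
    exact: jet_whitney_field jh hH].
- case=> // k _ x Kx; rewrite -hH//.
  (* This jet starts with h, so its entries are the iterated derivatives of h; comparing them gives
     assumption 2. *)
  have jets := area_primitive_jet 0 jf jg pX.
  have := jet_smooth jets k.+1.
  have -> : (fun x : R => 2 * (2^-1 * h x) + 0) = h by apply/funext => y; field.
  move=> ->; rewrite jmul_shift; congr (2 * _); apply: eq_bigr => i _.
  by rewrite /= !fF// !gG.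
- by move=> m; case: (HC m).
Qed.
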